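(* Consider Problem (B) with initial data $(\rho,u,E)(0,x)=(1,1,E_0)$ for $x<0$ (the piston moves toward the gas). For every $\gamma>1$ and $E_0>1/2$ (equivalently every Mach number $0<M_0<\infty$), let $\rho_1,\sigma,p_1,E_1$ be as in the context. Then the piecewise constant function $$(\rho,u,E)(t,x)=\begin{cases}(1,1,E_0), & x/t<\sigma,\\ (\rho_1,0,E_1), & \sigma<x/t\le 0,\end{cases}$$ is an integral weak solution of Problem (B), and the associated measures $\varrho=\rho\mathcal L^2$, $m=\rho u\mathcal L^2$, $n=\rho u^2\mathcal L^2$, $m^1=\rho E\mathcal L^2$, $n^1=\rho uE\mathcal L^2$, $n^2=up\mathcal L^2$, $\wp=p\mathcal L^2$, $w_p\equiv p_1$ (with $p=(\gamma-1)\rho(E-\tfrac12u^2)$) form a measure solution of Problem (B). Moreover: (Case 1) For fixed $\gamma>1$, as $E_0\downarrow 1/2$ (i.e. $M_0\to\infty$), these measure solutions converge weakly as measures (in the sense of the context) to the measure solution $\varrho=\rho\mathcal L^2$ (and corresponding $m,n,m^1,n^1,n^2,\wp$, $w_p\equiv\frac{\gamma+1}{2}$) induced by the integral weak solution of Problem (B) with $E_0=1/2$ $$(\rho,u,E)(t,x)=\begin{cases}(1,1,\tfrac12), & x/t<\frac{1-\gamma}{2},\\ \left(\frac{\gamma+1}{\gamma-1},0,\tfrac12\right), & \frac{1-\gamma}{2}<x/t< 0;\end{cases}$$ in particular there is no concentration of mass. (Case 2) For fixed $E_0>1/2$, as $\gamma\downarrow 1$ (i.e. $M_0\to\infty$,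 with $M_0$ and $\gamma$ related by $1/M_0^2=\gamma(\gamma-1)(E_0-\frac12)$), these measure solutions converge weakly as measures to $$\varrho=\mathsf I_\Omega\mathcal L^2+t\,\delta_P,\ m=\mathsf I_\Omega\mathcal L^2,\ n=\mathsf I_\Omega\mathcal L^2,\ m^1=E_0\mathsf I_\Omega\mathcal L^2+E_0t\,\delta_P,\ n^1=E_0\mathsf I_\Omega\mathcal L^2,\ n^2=0,\ \wp=0,\ w_p\equiv 1,$$ and these limiting measures constitute a (singular) measure solution of Problem (B) with $\gamma=1$, $M_0=\infty$, namely $(\varrho,u,E)=(\mathsf I_\Omega\mathcal L^2+t\delta_P,\ \mathsf I_\Omega,\ E_0)$ on the support of $\varrho$ (so $u=0$ on $P$), whose density contains a Dirac measure on the piston with weight $t$.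
   Context: Setting (coordinates moving with the piston, nondimensionalized): $\Omega=\{(t,x):x<0,\ t>0\}$, piston trajectory $P=\{(t,0):t\ge0\}$. The one-dimensional full compressible Euler system is $\partial_t\rho+\partial_x(\rho u)=0$, $\partial_t(\rho u)+\partial_x(\rho u^2+p)=0$, $\partial_t(\rho E)+\partial_x(\rho uE+up)=0$, with state relation $p=(\gamma-1)\rho(E-\frac12u^2)$, $\gamma\ge1$. Problem (B): these equations in $\Omega$, boundary condition $u=0$ on $P$, initial data $(\rho,u,E)(0,x)=(1,\pm1,E_0)$ for $x<0$ ($+1$: piston moves toward the gas; $-1$: piston recedes). The initial pressure is $p_0=(\gamma-1)(E_0-\frac12)$ and the Mach number $M_0\in(0,\infty]$ satisfies $\frac1{M_0^2}=\gamma(\gamma-1)(E_0-\frac12)$, so $p_0=\frac1{\gamma M_0^2}$, $E_0=\frac12+\frac1{\gamma(\gamma-1)M_0^2}$. Shock state (rushing case): $\rho_1=1+\dfrac{p_0+1-(\gamma-1)E_0+\sqrt{((\gamma-1)E_0-p_0-1)^2+4(\gamma-1)(E_0+p_0)}}{2(\gamma-1)(E_0+p_0)}$, $\sigma=-\frac1{\rho_1-1}$, $p_1=p_0+1+\frac1{\rho_1-1}$, $E_1=\frac1{\rho_1}\big((\rho_1-1)(E_0+p_0)+E_0\big)$. Integral weak solution: $(\rho,u,E)\in L^\infty(\Omega;\mathbb R^3)$ such that for all $\phi\in C^1_0(\mathbb R^2)$: $\int_\Omega(\rho\phi_t+\rho u\phi_x)+\int_{-\infty}^0\rho_0\phi(0,x)dx=0$;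 $\int_\Omega(\rho u\phi_t+(\rho u^2+p)\phi_x)-\int_0^\infty p(t,0)\phi(t,0)dt+\int_{-\infty}^0\rho_0u_0\phi(0,x)dx=0$; $\int_\Omega(\rho E\phi_t+(\rho uE+up)\phi_x)+\int_{-\infty}^0\rho_0E_0\phi(0,x)dx=0$; and every discontinuity in $\Omega$ satisfies the Lax entropy condition. Notation: $\mathcal L^2$ is Lebesgue measure; $\mathsf I_A$ the indicator of $A$; for a locally integrable weight $w$ on $[0,\infty)$, $w\delta_P$ is the measure $\langle w\delta_P,\phi\rangle=\int_0^\infty w(t)\phi(t,0)\,dt$; $\langle\mu,\phi\rangle=\int_{\bar\Omega}\phi\,d\mu$. Measure solution: Radon measures $\varrho,m,n,m^1,n^1,n^2,\wp$ supported on $\bar\Omega$, a function $w_p\in L^1_{loc}([0,\infty))$, and $\varrho$-measurable $u,E$ such that (i) for all $\phi\in C^1_0(\mathbb R^2)$: $\langle\varrho,\phi_t\rangle+\langle m,\phi_x\rangle+\int_{-\infty}^0\rho_0\phi(0,x)dx=0$; $\langle m,\phi_t\rangle+\langle n,\phi_x\rangle+\langle\wp,\phi_x\rangle-\langle w_p\delta_P,\phi\rangle+\int_{-\infty}^0\rho_0u_0\phi(0,x)dx=0$; $\langle m^1,\phi_t\rangle+\langle n^1,\phi_x\rangle+\langle n^2,\phi_x\rangle+\int_{-\infty}^0\rho_0E_0\phi(0,x)dx=0$; (ii) $\varrho\ge0$, $m\ll\varrho$, $n\ll m$, $m^1\ll\varrho$, $n^1\ll m^1$, $n^2\ll\wp$,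 $\wp\ll\varrho$, and $u=\frac{dm}{d\varrho}=\frac{dn}{dm}=\frac{dn^1}{dm^1}=\frac{dn^2}{d\wp}$, $E=\frac{dm^1}{d\varrho}$, with $u=E=0$ where $\varrho=0$; (iii) wherever, in an open neighborhood $\mathcal O$, $\varrho=\rho\mathcal L^2$ and $\wp=p\mathcal L^2$, one has $p=(\gamma-1)\rho(E-\frac12u^2)$ a.e. in $\mathcal O$ and the Lax entropy condition holds for discontinuities of $\rho,u,E$ there. Weak convergence as measures of measure solutions: each of the measures $\varrho_k,m_k,n_k,m^1_k,n^1_k,n^2_k,\wp_k$ converges weakly (vaguely, against $C_0(\mathbb R^2)$) to the corresponding limit measure, and $w_p^k\to w_p$ in $L^1_{loc}([0,\infty))$. *)

(* Defs.v *)
From HB Require Import structures.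
From mathcomp Require Import all_boot all_order all_algebra.
From mathcomp Require Import all_classical all_reals all_analysis.
From mathcomp Require Import measurable_realfun.
Import Order.TTheory GRing.Theory Num.Theory.
Local Open Scope classical_set_scope.
Local Open Scope ring_scope.

Set Implicit Arguments.
Unset Strict Implicit.
Unset Printing Implicit Defensive.

Notation pt R := (measurableTypeR R * measurableTypeR R)%type.

Definition leb2 {R : realType} : {measure set (pt R) -> \bar R} :=
  (@lebesgue_measure R \x @lebesgue_measure R)%E.

Section dmeas.
Local Open Scope ereal_scope.
Context d (T : measurableType d) (R : realType) (mu : {measure set T -> \bar R})
  (f : T -> R).

Definition dens_fun (x : T) : \bar R :=
  if `[< measurable_fun setT f /\ (forall y, (0 <= f y)%R) >] then (f x)%:E else 0.

Definition dmeas (A : set T) : \bar R := \int[mu]_(x in A) dens_fun x.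

Let dmeas0 : dmeas set0 = 0.
Proof. exact: integral_set0. Qed.

Let dmeas_ge0 A : 0 <= dmeas A.
Proof.
apply: integral_ge0 => x _; rewrite /dens_fun; case: asboolP => // -[_ h].
by rewrite lee_fin.
Qed.

Let dmeas_sigma_additive : semi_sigma_additive dmeas.
Proof.
move=> F mF tF mUF; rewrite /dmeas ge0_integral_bigcup //.
- apply: is_cvg_ereal_nneg_natsum => n _; apply: integral_ge0 => x _.
  rewrite /dens_fun; case: asboolP => // -[_ h]; by rewrite lee_fin.
- rewrite /dens_fun; case: asboolP => [[mf _]|_].
    by apply/measurable_EFinP; exact: measurable_funS mf.
  exact: measurable_cst.
- move=> x _; rewrite /dens_fun; case: asboolP => // -[_ h]; by rewrite lee_fin.
Qed.

HB.instance Definition _ := isMeasure.Build _ _ _ dmeas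
  dmeas0 dmeas_ge0 dmeas_sigma_additive.

End dmeas.

Section line_measure.
Local Open Scope ereal_scope.
Context (R : realType).

Definition emb_P (t : measurableTypeR R) : pt R := (t, 0%R).

Let memb : measurable_fun setT emb_P.
Proof. by apply: measurable_fun_pair => //; exact: measurable_cst. Qed.

(* w delta_P : A |-> \int_{[0,oo)} w(t) 1_A(t,0) dt  (w >= 0 on [0,oo)) *)
Definition lmeas (w : R -> R) : set (pt R) -> \bar R :=
  pushforward (dmeas (@lebesgue_measure R)
     (fun t : measurableTypeR R => if (0 <= t)%R then w t else 0%R)) emb_P.

Let lmeas0 w : lmeas w set0 = 0.
Proof. by rewrite /lmeas /pushforward preimage_set0 measure0. Qed.
Let lmeas_ge0 w A : 0 <= lmeas w A.
Proof. exact: measure_ge0. Qed.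
Let lmeas_sa w : semi_sigma_additive (lmeas w).
Proof.
move=> F mF tF mUF; rewrite /lmeas /pushforward preimage_bigcup.
apply: measure_semi_sigma_additive.
- by move=> n; rewrite -[X in measurable X]setTI; exact: memb.
- apply/trivIsetP => /= i j _ _ ij; rewrite -preimage_setI.
  by move/trivIsetP : tF => /(_ _ _ _ _ ij) ->//; rewrite preimage_set0.
- by rewrite -preimage_bigcup -[X in measurable X]setTI; exact: memb.
Qed.

HB.instance Definition _ w := isMeasure.Build _ _ _ (lmeas w)
  (lmeas0 w) (lmeas_ge0 w) (@lmeas_sa w).

End line_measure.

Section defs.
Context {R : realType}.
Local Open Scope ring_scope.

Definition leb1 : {measure set (measurableTypeR R) -> \bar R} := @lebesgue_measure R.

(* f L^2 + g t delta_P, for nonnegative measurable densities f, g *)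
Definition DL (f : pt R -> R) (g : R -> R) : {measure set (pt R) -> \bar R} :=
  measure_add (dmeas leb2 f) (lmeas g).

(* Signed Radon measures, represented as a difference of two nonnegative
   measures (Jordan-type decomposition). *)
Record smeas := SM { smp : {measure set (pt R) -> \bar R};
                     smn : {measure set (pt R) -> \bar R} }.

Definition DLs (f : pt R -> R) (g : R -> R) : smeas := SM (DL f g) mzero.

Definition square (X : pt R) (r : R) : set (pt R) :=
  [set Y | `|Y.1 - X.1| < r /\ `|Y.2 - X.2| < r].
Definition bsquare (M : R) : set (pt R) := [set Y | `|Y.1| <= M /\ `|Y.2| <= M].
Definition bnd (A : set (pt R)) := exists M, A `<=` bsquare M.
Definition openS (O : set (pt R)) :=
  forall X, O X -> exists2 r, 0 < r & square X r `<=` O.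

Definition Omega : set (pt R) := [set X | 0 < X.1 /\ X.2 < 0].
Definition Omegab : set (pt R) := [set X | 0 <= X.1 /\ X.2 <= 0].

Definition radon (mu : {measure set (pt R) -> \bar R}) :=
  forall M, 0 < M -> (mu (bsquare M) < +oo)%E.
Definition sradon (m : smeas) := radon (smp m) /\ radon (smn m).
Definition supp_Ob (m : smeas) :=
  smp m (~` Omegab) = 0%E /\ smn m (~` Omegab) = 0%E.

Definition spair (m : smeas) (phi : pt R -> R) : R :=
  Rintegral (smp m) setT phi - Rintegral (smn m) setT phi.
(* value on a bounded measurable set *)
Definition sval (m : smeas) (A : set (pt R)) : R :=
  fine (smp m A) - fine (smn m A).

Definition sdens (nu : smeas) (u : pt R -> R) (mu : smeas) :=
  forall A, measurable A -> bnd A ->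
    (smp mu).-integrable A (EFin \o u) /\ (smn mu).-integrable A (EFin \o u) /\
    sval nu A = Rintegral (smp mu) A u - Rintegral (smn mu) A u.

(* N is |mu|-null *)
Definition snull (mu : smeas) (N : set (pt R)) :=
  forall B, measurable B -> bnd B -> B `<=` N -> sval mu B = 0.
Definition sabs (nu mu : smeas) :=
  forall N, measurable N -> snull mu N -> snull nu N.
Definition snonneg (mu : smeas) :=
  forall A, measurable A -> bnd A -> 0 <= sval mu A.

Definition sL2_on (O : set (pt R)) (mu : smeas) (f : pt R -> R) :=
  forall A, measurable A -> bnd A -> A `<=` O ->
    leb2.-integrable A (EFin \o f) /\ sval mu A = Rintegral leb2 A f.

Definition cont2 (f : pt R -> R) :=
  forall X e, 0 < e -> exists2 d, 0 < d &
    forall Y, `|Y.1 - X.1| < d -> `|Y.2 - X.2| < d -> `|f Y - f X| < e.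
Definition csupp2 (f : pt R -> R) :=
  exists2 M, 0 < M & forall X, ~ bsquare M X -> f X = 0.
Definition C10 (phi phit phix : pt R -> R) :=
  csupp2 phi /\ cont2 phi /\ cont2 phit /\ cont2 phix /\
  (forall X : pt R, is_derive (X.1 : R) (1 : R) (fun s : R => phi (s, X.2)) (phit X)) /\
  (forall X : pt R, is_derive (X.2 : R) (1 : R) (fun y : R => phi (X.1, y)) (phix X)).

Definition press (gam r u E : R) := (gam - 1) * r * (E - u ^+ 2 / 2).
Definition sndspd (gam r u E : R) := Num.sqrt (gam * press gam r u E / r).
Definition lam1 gam (U : R * R * R) := U.1.2 - sndspd gam U.1.1 U.1.2 U.2.
Definition lam2 (U : R * R * R) := U.1.2.
Definition lam3 gam (U : R * R * R) := U.1.2 + sndspd gam U.1.1 U.1.2 U.2.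

(* Lax entropy condition for a discontinuity of speed s with left state Ul
   (smaller x) and right state Ur; states are (rho, u, E). *)
Definition lax_adm gam (Ul Ur : R * R * R) (s : R) :=
  (lam1 gam Ur < s < lam1 gam Ul /\ s < lam2 Ur) \/
  (lam2 Ul = s /\ s = lam2 Ur) \/
  (lam2 Ul < s /\ lam3 gam Ur < s < lam3 gam Ul).

Definition dist3 (U V : R * R * R) :=
  `|U.1.1 - V.1.1| + `|U.1.2 - V.1.2| + `|U.2 - V.2|.
Definition hball (X0 : pt R) (s r : R) (left : bool) : set (pt R) :=
  [set X | (X.1 - X0.1) ^+ 2 + (X.2 - X0.2) ^+ 2 < r ^+ 2 /\
           (if left then X.2 - X0.2 < s * (X.1 - X0.1)
            else s * (X.1 - X0.1) < X.2 - X0.2)].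
(* X0 is an (approximate) jump point of U across the line of speed s
   through X0, with one-sided approximate limits Ul (left) and Ur (right) *)
Definition jump_pt (U : pt R -> R * R * R) (X0 : pt R) (s : R) (Ul Ur : R * R * R) :=
  Ul <> Ur /\
  forall e, 0 < e -> exists2 d, 0 < d & forall r, 0 < r < d ->
    (\int[leb2]_(X in hball X0 s r true) (dist3 (U X) Ul)%:E <= (e * r ^+ 2)%:E)%E /\
    (\int[leb2]_(X in hball X0 s r false) (dist3 (U X) Ur)%:E <= (e * r ^+ 2)%:E)%E.
Definition lax_ok gam (O : set (pt R)) (rho u E : pt R -> R) :=
  forall X0 s Ul Ur, O X0 -> Omega X0 ->
    jump_pt (fun X => (rho X, u X, E X)) X0 s Ul Ur -> lax_adm gam Ul Ur s.

(* initial data (rho0,u0,E0) = (1,u0,E0) *)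
Definition weak_sol gam (u0 E0 : R) (rho u E : pt R -> R) :=
  let p X := press gam (rho X) (u X) (E X) in
  (measurable_fun Omega rho /\ measurable_fun Omega u /\ measurable_fun Omega E /\
   exists M, forall X, Omega X -> `|rho X| <= M /\ `|u X| <= M /\ `|E X| <= M) /\
  (forall phi phit phix, C10 phi phit phix ->
    Rintegral leb2 Omega (fun X => rho X * phit X + rho X * u X * phix X)
      + Rintegral leb1 `]-oo, 0[ (fun x => 1 * phi (0, x)) = 0 /\
    Rintegral leb2 Omega (fun X => rho X * u X * phit X
                                    + (rho X * u X ^+ 2 + p X) * phix X)
      - Rintegral leb1 `[0, +oo[ (fun t => p (t, 0) * phi (t, 0))
      + Rintegral leb1 `]-oo, 0[ (fun x => 1 * u0 * phi (0, x)) = 0 /\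
    Rintegral leb2 Omega (fun X => rho X * E X * phit X
                                    + (rho X * u X * E X + u X * p X) * phix X)
      + Rintegral leb1 `]-oo, 0[ (fun x => 1 * E0 * phi (0, x)) = 0) /\
  lax_ok gam Omega rho u E.

Record msdata := MSD {
  Mrho : smeas; Mm : smeas; Mn : smeas; Mm1 : smeas; Mn1 : smeas; Mn2 : smeas;
  Mp : smeas; Mwp : R -> R; Mu : pt R -> R; ME : pt R -> R }.

Definition wdelta (w : R -> R) (phi : pt R -> R) :=
  Rintegral leb1 `[0, +oo[ (fun t => w t * phi (t, 0)).

Definition measure_sol gam (u0 E0 : R) (D : msdata) :=
  let: MSD rho m n m1 n1 n2 pp wp u E := D in
  (let ok mu := sradon mu /\ supp_Ob mu in
   ok rho /\ ok m /\ ok n /\ ok m1 /\ ok n1 /\ ok n2 /\ ok pp) /\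
  (forall T, 0 < T -> leb1.-integrable `[0, T] (EFin \o wp)) /\
  (forall phi phit phix, C10 phi phit phix ->
    spair rho phit + spair m phix + Rintegral leb1 `]-oo, 0[ (fun x => 1 * phi (0, x)) = 0 /\
    spair m phit + spair n phix + spair pp phix - wdelta wp phi
      + Rintegral leb1 `]-oo, 0[ (fun x => 1 * u0 * phi (0, x)) = 0 /\
    spair m1 phit + spair n1 phix + spair n2 phix
      + Rintegral leb1 `]-oo, 0[ (fun x => 1 * E0 * phi (0, x)) = 0) /\
  (snonneg rho /\ sdens m u rho /\ sdens n u m /\ sdens m1 E rho /\
   sdens n1 u m1 /\ sdens n2 u pp /\ sabs pp rho /\
   (forall X, (exists2 r, 0 < r & snull rho (square X r)) -> u X = 0 /\ E X = 0)) /\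
  (forall (O : set (pt R)) (dr dp : pt R -> R), openS O -> sL2_on O rho dr -> sL2_on O pp dp ->
     {ae leb2, forall X, O X -> dp X = press gam (dr X) (u X) (E X)} /\
     lax_ok gam O dr u E).

Definition conv_right (F : R -> R) (a L : R) :=
  forall e, 0 < e -> exists2 d, 0 < d &
    forall y, a < y < a + d -> `|F y - L| < e.

Definition wconv_right (mu : R -> smeas) (a : R) (mu0 : smeas) :=
  forall phi, cont2 phi -> csupp2 phi ->
    conv_right (fun y => spair (mu y) phi) a (spair mu0 phi).

Definition msol_conv_right (D : R -> msdata) (a : R) (D0 : msdata) :=
  wconv_right (fun y => Mrho (D y)) a (Mrho D0) /\
  wconv_right (fun y => Mm (D y)) a (Mm D0) /\
  wconv_right (fun y => Mn (D y)) a (Mn D0) /\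
  wconv_right (fun y => Mm1 (D y)) a (Mm1 D0) /\
  wconv_right (fun y => Mn1 (D y)) a (Mn1 D0) /\
  wconv_right (fun y => Mn2 (D y)) a (Mn2 D0) /\
  wconv_right (fun y => Mp (D y)) a (Mp D0) /\
  (forall T, 0 < T ->
     conv_right (fun y => Rintegral leb1 `[0, T] (fun t => `|Mwp (D y) t - Mwp D0 t|)) a 0).

Definition p0 gam E0 : R := (gam - 1) * (E0 - 1 / 2).
Definition rho1 gam E0 : R :=
  1 + (p0 gam E0 + 1 - (gam - 1) * E0 +
       Num.sqrt (((gam - 1) * E0 - p0 gam E0 - 1) ^+ 2
                 + 4 * (gam - 1) * (E0 + p0 gam E0)))
      / (2 * (gam - 1) * (E0 + p0 gam E0)).
Definition sigma gam E0 : R := - (1 / (rho1 gam E0 - 1)).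
Definition p1 gam E0 : R := p0 gam E0 + 1 + 1 / (rho1 gam E0 - 1).
Definition E1 gam E0 : R :=
  (1 / rho1 gam E0) * ((rho1 gam E0 - 1) * (E0 + p0 gam E0) + E0).

Definition pc3 (s : R) (Ul Ur : R * R * R) (X : pt R) : R * R * R :=
  if (0 <= X.1) && (X.2 <= 0) then (if X.2 < s * X.1 then Ul else Ur)
  else (0, 0, 0).

Definition solB gam E0 : pt R -> R * R * R :=
  pc3 (sigma gam E0) (1, 1, E0) (rho1 gam E0, 0, E1 gam E0).
Definition solB0 gam : pt R -> R * R * R :=
  pc3 ((1 - gam) / 2) (1, 1, 1 / 2) ((gam + 1) / (gam - 1), 0, 1 / 2).

Definition induced_ms gam (U : pt R -> R * R * R) (wp : R -> R) : msdata :=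
  let rho X := (U X).1.1 in let u X := (U X).1.2 in let E X := (U X).2 in
  let p X := press gam (rho X) (u X) (E X) in
  MSD (DLs rho (fun _ => 0)) (DLs (fun X => rho X * u X) (fun _ => 0))
      (DLs (fun X => rho X * u X ^+ 2) (fun _ => 0))
      (DLs (fun X => rho X * E X) (fun _ => 0))
      (DLs (fun X => rho X * u X * E X) (fun _ => 0))
      (DLs (fun X => u X * p X) (fun _ => 0))
      (DLs p (fun _ => 0)) wp u E.

Definition indO (X : pt R) : R := if (0 < X.1) && (X.2 < 0) then 1 else 0.
Definition indOb (X : pt R) : R := if (0 <= X.1) && (X.2 <= 0) then 1 else 0.

Definition sing_ms (E0 : R) : msdata :=
  MSD (DLs indO (fun t => t)) (DLs indO (fun _ => 0)) (DLs indO (fun _ => 0))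
      (DLs (fun X => E0 * indO X) (fun t => E0 * t))
      (DLs (fun X => E0 * indO X) (fun _ => 0))
      (DLs (fun _ => 0) (fun _ => 0)) (DLs (fun _ => 0) (fun _ => 0))
      (fun _ => 1) indO (fun X => E0 * indOb X).

End defs.

(* Main.v *)
(** With [z = - sigma] the Rankine-Hugoniot relations reduce to [z ^ 2 + B z = A],
where [B = (3 - gamma) / 2] and [A = (gamma - 1) (E0 + p0)]; the positive root
gives [rho1 = (1 + z) / z] and [p1 = p0 + 1 + z].  All formulas extend to
[E0 = 1/2], where they give the limiting solution of Case 1.  Integrating over the
two wedges separated by [x = - z t] (Fubini and the fundamental theorem of
calculus) turns each weak equation into a Rankine-Hugoniot defect.  At a jump
point the one-sided limits are tested on small squares inside the half-balls,
which forces the speed and the two states to be those of the shock.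
In the limits only the integral of the test function over the wedge
[- z t <= x < 0] depends on [z]: it is Lipschitz in [z], and for [z -> 0] it is
[z] times the integral of [t phi(t,0)], up to [o(z)].  As [z rho1 = 1 + z], the mass
between shock and piston tends to [t delta_P] when [gamma -> 1]. *)

Require Import Defs.
From HB Require Import structures.
From mathcomp Require Import all_boot all_order all_algebra.
From mathcomp Require Import all_classical all_reals all_analysis.
From mathcomp Require Import ring lra measurable_realfun.
Import Order.TTheory GRing.Theory Num.Theory.
Import numFieldNormedType.Exports.
Local Open Scope classical_set_scope.
Local Open Scope ring_scope.

Set Implicit Arguments.
Unset Strict Implicit.
Unset Printing Implicit Defensive.

(** The quadratic for [z] arises as follows: with [z = 1 / (rho1 - 1)] the mass relation holds
    identically, momentum fixes the pressure, energy fixes [rho1 * E1], and the state law then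
    leaves one equation for [z]. Test functions are cut by wedge indicators at once, so continuity
    is lost; [bcs] keeps just what Fubini and integrability against Radon measures require. A
    density counts only if it is measurable on the whole plane and nonnegative ([dens_fun] is 0
    otherwise), so all densities are extended by 0 and signs are carried through the limits. The
    entropy condition speaks of every approximate jump point, with arbitrary speed and states, and
    of a density known only up to a null set. Point values are therefore useless there: a state is
    identified through its weight on squares of size proportional to the ball. In Case 2 the density
    behind the shock grows like [1 / z] while the area of the layer shrinks like [z]; continuity in
    [z] is too weak for this product, hence the first-order expansion of the layer integral. *)

Definition bcs {R : realType} (f : pt R -> R) :=
  measurable_fun setT f /\ (exists C : R, forall X, `|f X| <= C) /\ csupp2 f.

Definition bcs1 {R : realType} (f : measurableTypeR R -> R) :=
  measurable_fun setT f /\ (exists C : R, forall t, `|f t| <= C) /\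
  (exists2 M : R, 0 < M & forall t, ~ (`|t| <= M) -> f t = 0).

(** * Bounded measurable functions of bounded support; open sets of the plane *)

Section basics.
Context {R : realType}.
Implicit Types (f g h : pt R -> R) (X Y : pt R).

Lemma bfs_integrable d (T : measurableType d) (mu : {measure set T -> \bar R})
    (D : set T) (f : T -> R) (C : R) :
  measurable D -> (mu D < +oo)%E -> measurable_fun setT f ->
  (forall x, `|f x| <= C) -> (forall x, ~ D x -> f x = 0) ->
  mu.-integrable setT (EFin \o f).
Proof.
move=> mD muD mf fC f0.
have -> : EFin \o f = (EFin \o f) \_ D.
  apply/funext => x; rewrite /patch; case: ifPn => // /negP xD /=.
  by rewrite f0 // => /mem_set.
apply/(integrable_mkcond _ mD); apply: measurable_bounded_integrable => //.
  exact: measurable_funS mf.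
exists C; split; first exact: num_real.
by move=> y Cy x _; apply: le_trans (fC x) (ltW Cy).
Qed.

Lemma bsquareE (M : R) : bsquare M = `[- M, M]%classic `*` `[- M, M]%classic.
Proof.
by apply/seteqP; split=> -[t x]; rewrite /bsquare /= !in_itv /= !ler_norml => -[].
Qed.

Lemma measurable_bsquare (M : R) : measurable (bsquare M : set (pt R)).
Proof. by rewrite bsquareE; apply: measurableX. Qed.

Lemma leb2_rect (A B : set (measurableTypeR R)) : measurable A -> measurable B ->
  leb2 (A `*` B) = (leb1 A * leb1 B)%E.
Proof. by move=> mA mB; exact: product_measure1E. Qed.

Lemma leb1_itv (b0 b1 : bool) (a b : R) : a <= b ->
  leb1 [set` Interval (BSide b0 a) (BSide b1 b)] = (b - a)%:E.
Proof.
move=> ab; apply: etrans (lebesgue_measure_itv _) _ => /=; rewrite lte_fin.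
case: ltP => [_|ba]; first by rewrite -EFinD.
by congr EFin; lra.
Qed.

Lemma radon_leb2 : radon (@leb2 R).
Proof.
move=> M M0; rewrite bsquareE leb2_rect //.
have h : - M <= M by lra.
by rewrite !(leb1_itv _ _ h) -EFinM ltry.
Qed.

Lemma bcs_integrable (mu : {measure set (pt R) -> \bar R}) f :
  radon mu -> bcs f -> mu.-integrable setT (EFin \o f).
Proof.
move=> rmu [mf [[C fC] [M M0 fM]]].
exact: (bfs_integrable (measurable_bsquare M) (rmu _ M0) mf fC fM).
Qed.

Lemma bcs1_integrable (f : measurableTypeR R -> R) : bcs1 f ->
  leb1.-integrable setT (EFin \o f).
Proof.
move=> [mf [[C fC] [M M0 fM]]].
apply: (@bfs_integrable _ _ leb1 (`[- M, M]%classic : set R) f C) => //.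
  by rewrite leb1_itv ?ltry //; lra.
by move=> x h; apply: fM; rewrite ler_norml => hx; apply: h; rewrite /= in_itv.
Qed.

Lemma bcsM f g : bcs f -> measurable_fun setT g -> (exists C : R, forall X, `|g X| <= C) ->
  bcs (fun X => f X * g X).
Proof.
move=> [mf [[C fC] [M M0 fM]]] mg [D gD]; split; first exact: measurable_funM.
split; last by exists M => // X h; rewrite fM // mul0r.
by exists (C * D) => X; rewrite normrM ler_pM.
Qed.

Lemma bcsZ (c : R) f : bcs f -> bcs (fun X => c * f X).
Proof.
move=> [mf [[C fC] [M M0 fM]]]; split.
  by apply: measurable_funM => //; exact: measurable_cst.
split; last by exists M => // X h; rewrite fM // mulr0.
by exists (`|c| * C) => X; rewrite normrM ler_pM.
Qed.

Lemma csupp2_weak (M N : R) f : M <= N ->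
  (forall X, ~ bsquare M X -> f X = 0) -> forall X, ~ bsquare N X -> f X = 0.
Proof.
move=> MN fM X XN; apply: fM => -[h1 h2]; apply: XN.
by split; [apply: le_trans h1 MN|apply: le_trans h2 MN].
Qed.

Lemma bcsD f g : bcs f -> bcs g -> bcs (fun X => f X + g X).
Proof.
move=> [mf [[C fC] [M M0 fM]]] [mg [[D gD] [N N0 gN]]].
split; first exact: measurable_funD.
split.
  by exists (C + D) => X; apply: le_trans (ler_normD _ _) _; apply: lerD.
exists (Num.max M N); first by rewrite lt_max M0.
move=> X hX; rewrite (csupp2_weak _ fM hX) ?(csupp2_weak _ gN hX) ?addr0 //.
  by rewrite le_max lexx orbT.
by rewrite le_max lexx.
Qed.

(** Local boundedness of [g] is enough since [f] vanishes outside a bounded interval; the case in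
    view is the time weight [g t = t]. *)
Lemma bcs1M (f g : measurableTypeR R -> R) : bcs1 f -> measurable_fun setT g ->
  (forall K, exists C : R, forall t, `|t| <= K -> `|g t| <= C) ->
  bcs1 (fun t => f t * g t).
Proof.
move=> [mf [[C fC] [M M0 fM]]] mg /(_ M)[D gD].
split; first exact: measurable_funM.
split; last by exists M => // X h; rewrite fM // mul0r.
exists (C * `|D|) => t; case: (pselect (`|t| <= M)) => h; last first.
  by rewrite fM // mul0r normr0 mulr_ge0 // (le_trans _ (fC t)).
by rewrite normrM ler_pM // (le_trans (gD _ h)) // ler_norm.
Qed.

Lemma bcs_pairt f (t : R) : bcs f -> bcs1 (fun x : measurableTypeR R => f (t, x)).
Proof.
move=> [mf [[C fC] [M M0 fM]]]; split.
  apply: measurableT_comp => //.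
split; first by exists C.
by exists M => // x h; apply: fM => -[].
Qed.

Lemma bcs_pairx f (x : R) : bcs f -> bcs1 (fun t : measurableTypeR R => f (t, x)).
Proof.
move=> [mf [[C fC] [M M0 fM]]]; split.
  apply: measurableT_comp => //.
split; first by exists C.
by exists M => // t h; apply: fM => -[].
Qed.

Lemma leb2_fubini_tx f : bcs f ->
  Rintegral leb2 setT f =
  Rintegral leb1 setT (fun t => Rintegral leb1 setT (fun x => f (t, x))).
Proof.
move=> bf; have := bcs_integrable radon_leb2 bf => intf.
rewrite /Rintegral -[X in fine X](integral12_prod_meas1 intf).
congr fine; apply: eq_integral => t _; rewrite /fubini_F.
rewrite fineK //; apply: integrable_fin_num => //.
exact: (bcs1_integrable (bcs_pairt t bf)).
Qed.

Lemma leb2_fubini_xt f : bcs f ->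
  Rintegral leb2 setT f =
  Rintegral leb1 setT (fun x => Rintegral leb1 setT (fun t => f (t, x))).
Proof.
move=> bf; have := bcs_integrable radon_leb2 bf => intf.
rewrite /Rintegral -[X in fine X](integral21_prod_meas1 intf).
congr fine; apply: eq_integral => t _; rewrite /fubini_G.
rewrite fineK //; apply: integrable_fin_num => //.
exact: (bcs1_integrable (bcs_pairx t bf)).
Qed.

Lemma squareE X (r : R) :
  square X r = `]X.1 - r, X.1 + r[%classic `*` `]X.2 - r, X.2 + r[%classic.
Proof.
by apply/seteqP; split=> -[t x]; rewrite /square /= !in_itv /= !ltr_distl => -[].
Qed.

Lemma square_sub X (q r : R) : q <= r -> square X q `<=` square X r.
Proof. by move=> qr Y [h1 h2]; split; exact: lt_le_trans qr. Qed.

Lemma measurable_square X (r : R) : measurable (square X r).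
Proof. by rewrite squareE; apply: measurableX. Qed.

Lemma leb2_square X (r : R) : 0 < r -> leb2 (square X r) = ((2 * r) ^+ 2)%:E.
Proof.
move=> r0; rewrite squareE leb2_rect //.
have h (a : R) : a - r <= a + r by lra.
by rewrite !(leb1_itv _ _ (h _)) -EFinM; congr EFin; rewrite expr2; congr *%R; lra.
Qed.

Lemma rat_between (a b : R) : a < b -> exists q : rat, a < ratr q < b.
Proof. by move=> /rat_in_itvoo[q]; rewrite in_itv /=; exists q. Qed.

(** Squares with rational data form a countable base. The cover yields measurability of open sets,
    and later lets null sets found square by square be united into one. *)
Lemma openS_cover (O : set (pt R)) : openS O ->
  exists (c : nat -> pt R) (r : nat -> R),
    (forall n, square (c n) (r n) `<=` O) /\
    O = \bigcup_n square (c n) (r n).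
Proof.
move=> oO.
pose sq (q : rat * rat * rat) : set (pt R) :=
  square (ratr q.1.1, ratr q.1.2) (ratr q.2).
pose q n : rat * rat * rat := odflt (0, 0, 0) (unpickle n).
pose ok n := `[< sq (q n) `<=` O >].
exists (fun n => (ratr (q n).1.1, ratr (q n).1.2)).
(* A code whose square is not inside [O] gets radius 0, and that square is empty; no re-indexing is
   necessary. *)
exists (fun n => if ok n then ratr (q n).2 else 0).
have sub n : square (ratr (q n).1.1, ratr (q n).1.2)
    (if ok n then ratr (q n).2 else 0) `<=` O.
  case: ifPn => [/asboolP //|_] Y [] /=.
  by rewrite ltNge normr_ge0.
split=> //; apply/seteqP; split; last by move=> X [n _]; exact: sub.
move=> X OX; have [e e0 eO] := oO _ OX.
have [rr /andP[r0 r1]] := rat_between (ltac:(lra) : 0 < e / 2).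
have [ra /andP[a1 a2]] := rat_between (ltac:(lra) : X.1 - ratr rr < X.1 + ratr rr).
have [rb /andP[b1 b2]] := rat_between (ltac:(lra) : X.2 - ratr rr < X.2 + ratr rr).
have qE : q (pickle (ra, rb, rr)) = (ra, rb, rr) by rewrite /q pickleK.
move: (pickle _) qE => n qE; exists n => //.
have -> : ok n.
  apply/asboolP => Y; rewrite /sq qE /= => -[] /=.
  rewrite !ltr_distl => /andP[c1 c2] /andP[d1 d2].
  by apply: eO; split; rewrite ltr_distl; apply/andP; split; lra.
by rewrite qE /=; split; rewrite /= ltr_distl; apply/andP; split; lra.
Qed.

Lemma openS_measurable (O : set (pt R)) : openS O -> measurable O.
Proof.
move=> /openS_cover[c [r [_ ->]]]; apply: bigcupT_measurable => n.
exact: measurable_square.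
Qed.

Lemma cont2_measurable f : cont2 f -> measurable_fun setT f.
Proof.
move=> cf mT; apply: (measurability _ (RGenOInfty.measurableE R)) => //.
move=> _ [_ [a ->] <-]; rewrite setTI; apply: openS_measurable => X /=.
rewrite in_itv /= andbT => aX.
have [d d0 h] := cf X (f X - a) (ltac:(by rewrite subr_gt0)).
exists d => // Y [h1 h2] /=; rewrite in_itv /= andbT.
by have := h _ h1 h2; rewrite ltr_distl => /andP[+ _]; lra.
Qed.

End basics.

(** * Continuous functions with bounded support *)

Section cont2_theory.
Context {R : realType}.
Implicit Types (f : pt R -> R) (X Y : pt R).

Lemma cont2P f : cont2 f -> continuous (f : R * R -> R).
Proof.
move=> cf X; apply/cvgrPdist_lt => e e0; have [d d0 h] := cf X e e0.
exists (ball X.1 d, ball X.2 d) => /=.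
  by split; exact: nbhsx_ballx.
move=> [y1 y2] [/= h1 h2]; rewrite distrC; apply: h; rewrite distrC.
  exact: h1.
exact: h2.
Qed.

Lemma bsquare_compact (M : R) : compact (bsquare M : set (R * R)).
Proof. by rewrite bsquareE; apply: compact_setX; exact: segment_compact. Qed.

Lemma cont2_csupp2_bounded f : cont2 f -> csupp2 f -> exists C : R, forall X, `|f X| <= C.
Proof.
move=> /cont2P cf [M M0 fM].
have : bounded_set (f @` (bsquare M)).
  apply: compact_bounded; apply: continuous_compact; last exact: bsquare_compact.
  exact: continuous_subspaceT.
move=> [C [_ hC]]; exists (`|C| + 1) => X.
have C1 : C < `|C| + 1 by rewrite ltr_pwDr // ler_norm.
case: (pselect (bsquare M X)) => hX; first by apply: (hC _ C1); exists X.
by rewrite fM // normr0 addr_ge0.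
Qed.

Lemma cont2_bcs f : cont2 f -> csupp2 f -> bcs f.
Proof.
move=> cf sf; split; first exact: cont2_measurable.
by split=> //; exact: cont2_csupp2_bounded.
Qed.

(** Heine-Cantor, with compactness of the support square used in its near-covering form. If only [Y]
    lies in that square, the roles of [X] and [Y] are exchanged; if neither does, both values are
    0. *)
Lemma cont2_unif f : cont2 f -> csupp2 f -> forall e, 0 < e ->
  exists2 d : R, 0 < d & forall X Y,
    `|Y.1 - X.1| < d -> `|Y.2 - X.2| < d -> `|f Y - f X| < e.
Proof.
move=> cf [M M0 fM] e e0.
have ncov := (compact_near_coveringP _).1 (@bsquare_compact M).
pose P (d : R) (X : R * R) := forall Y : pt R,
    `|Y.1 - X.1| < d -> `|Y.2 - X.2| < d -> `|f Y - f X| < e.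
have : \forall d \near 0^'+, (bsquare M : set (R * R)) `<=` P d.
  apply: ncov => X _.
  have e2 : 0 < e / 2 by lra.
  have [d d0 h] := cf X (e / 2) e2.
  exists (ball X (d / 2), [set r : R | r < d / 2]) => /=.
    split; first by apply: nbhsx_ballx; lra.
    by apply: nbhs_right_lt; lra.
  move=> [X' r] [/= [/= h1 h2] rd] Y Y1 Y2.
  rewrite /ball /= in h1 h2.
  have := h X'; rewrite distrC => /(_ (ltac:(lra))); rewrite distrC => /(_ (ltac:(lra))) H1.
  have H2 : `|f Y - f X| < e / 2.
    apply: h.
      by have := ler_distD X'.1 Y.1 X.1; rewrite (distrC X'.1); lra.
    by have := ler_distD X'.2 Y.2 X.2; rewrite (distrC X'.2); lra.
  by have := ler_distD (f X) (f Y) (f X'); rewrite (distrC (f X)); lra.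
move=> h; have {h}[d [d0 hd]] : exists d : R, 0 < d /\ (bsquare M : set (R * R)) `<=` P d.
  near (0 : R)^'+ => d; exists d; split; first by near: d; exact: nbhs_right_gt.
  by near: d.
exists d => // X Y h1 h2.
case: (pselect (bsquare M X)) => hX; first exact: (hd X hX Y).
case: (pselect (bsquare M Y)) => hY; last by rewrite !fM // subrr normr0.
by rewrite distrC; apply: (hd Y hY X); rewrite distrC.
Unshelve. all: by end_near. Qed.

End cont2_theory.

(** * The fundamental theorem of calculus on wedges *)

Section ftc_line.
Context {R : realType}.
Implicit Types (f k : R -> R).

Lemma is_derive_continuous f (k : R -> R) : (forall x : R, is_derive x (1 : R) f (k x)) ->
  continuous f.
Proof.
move=> df x; apply/differentiable_continuous/derivable1_diffP.
exact: ex_derive.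
Qed.

Lemma Rintegral_derive (f k : R -> R) (a b : R) : a <= b ->
  (forall x : R, is_derive x (1 : R) f (k x)) -> continuous k ->
  Rintegral leb1 `[a, b]%classic k = f b - f a.
Proof.
rewrite le_eqVlt => /orP[/eqP -> _ _|ab df ck].
  by rewrite set_itv1 /leb1 Rintegral_set1 subrr.
have cf := is_derive_continuous df.
rewrite /Rintegral /leb1 (@continuous_FTC2 _ k f a b) //.
- exact: continuous_subspaceT.
- split; first by move=> x _; exact: ex_derive.
    exact/cvg_at_right_filter/cf.
  exact/cvg_at_left_filter/cf.
- by move=> x _; rewrite derive1E derive_val.
Qed.

(** The alternative [k x = 0] lets a half-line be replaced by a bounded interval beyond which [k]
    vanishes, which is the setting of the one-dimensional theorems applied below. *)
Lemma Rintegral_ind (A : set R) (P : R -> bool) (k : R -> R) :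
  (forall x, (x \in A) = P x \/ k x = 0) ->
  Rintegral leb1 setT (fun x : R => (P x)%:R * k x) = Rintegral leb1 A k.
Proof.
move=> h; rewrite [RHS]Rintegral_mkcond; congr (Rintegral _ _ _).
apply/funext => x; rewrite /patch; case: (h x) => [->|->].
  by case: (P x); rewrite ?mul1r ?mul0r.
by rewrite mulr0; case: ifP.
Qed.

Lemma continuous_integrable_itv (k : R -> R) (a b : R) : continuous k ->
  leb1.-integrable `[a, b]%classic (EFin \o k).
Proof.
move=> ck; apply: continuous_compact_integrable; first exact: segment_compact.
exact: continuous_subspaceT.
Qed.

(** The set where [|x| > M] is open, so [f] is locally the zero function there. *)
Lemma derive_supp (f k : R -> R) (M : R) : (forall x : R, is_derive x (1 : R) f (k x)) ->
  (forall x, ~ `|x| <= M -> f x = 0) -> forall x, ~ `|x| <= M -> k x = 0.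
Proof.
move=> df fM x xM.
have <- : 'D_1 f x = k x by apply: derive_val.
transitivity ('D_1 (cst (0 : R)) x); last by rewrite derive_cst.
apply: near_eq_derive.
have /negP := xM; rewrite -ltNge => xM'.
near=> y; apply: fM; apply/negP; rewrite -ltNge.
near: y.
have : (fun y : R => `|y|) @ x --> `|x| by apply: norm_continuous.
by move/cvgr_gt; apply.
Unshelve. all: by end_near. Qed.

Variables (f k : R -> R) (M : R).
Hypotheses (df : forall x : R, is_derive x (1 : R) f (k x)) (ck : continuous k)
  (fM : forall x, ~ `|x| <= M -> f x = 0).

Lemma Rintegral_derive_lt (a : R) :
  Rintegral leb1 setT (fun x : R => (x < a)%R%:R * k x) = f a.
Proof.
(* [L] lies to the left of both the support and [a], so the lower boundary term is 0. *)
pose L := Num.min (- M) a - 1.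
have [L1 L2] : L < - M /\ L < a.
  by rewrite /L; case: (leP (- M) a) => ?; split; lra.
have fL : f L = 0.
  by apply: fM => h; have := ler_norm (- L); rewrite normrN; lra.
rewrite (Rintegral_ind (A := `[L, a[%classic)).
  rewrite /leb1 Rintegral_itv_bndo_bndc; last first.
    apply: integrableS (continuous_integrable_itv L a ck) => //.
    exact: subset_itv_co_cc.
  by rewrite (Rintegral_derive (ltW L2) df ck) fL subr0.
move=> x; have [xL|xL] := leP L x.
  by left; rewrite mem_setE in_itv /= xL.
right; apply: (derive_supp df fM) => h.
by have := ler_norm (- x); rewrite normrN; lra.
Qed.

Lemma Rintegral_derive_ge (a : R) :
  Rintegral leb1 setT (fun x : R => (a <= x)%R%:R * k x) = - f a.
Proof.
pose L := Num.max M a + 1.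
have [L1 L2] : M < L /\ a < L.
  by rewrite /L; case: (leP M a) => ?; split; lra.
have fL : f L = 0.
  by apply: fM => h; have := ler_norm L; lra.
rewrite (Rintegral_ind (A := `[a, L]%classic)).
  by rewrite (Rintegral_derive (ltW L2) df ck) fL sub0r.
move=> x; have [xL|xL] := leP x L.
  by left; rewrite mem_setE in_itv /= xL andbT.
by right; apply: (derive_supp df fM) => h; have := ler_norm x; lra.
Qed.

Lemma Rintegral_derive_gt (a : R) :
  Rintegral leb1 setT (fun x : R => (a < x)%R%:R * k x) = - f a.
Proof.
rewrite -Rintegral_derive_ge.
rewrite /Rintegral; congr fine; apply: ae_eq_integral => //.
  - apply/measurable_EFinP/measurable_funM; last exact: continuous_measurable_fun.
    by apply: measurableT_comp => //; apply: measurable_fun_ltr.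
  - apply/measurable_EFinP/measurable_funM; last exact: continuous_measurable_fun.
    by apply: measurableT_comp => //; apply: measurable_fun_ler.
  exists [set a]; split => //; first exact: lebesgue_measure_set1.
  move=> x /= h; apply/eqP; apply/negPn/negP => xa; apply: h => _.
  by rewrite lt_neqAle eq_sym xa.
Qed.

End ftc_line.

(** * Derivatives of test functions integrated over wedges *)

Section wedge.
Context {R : realType}.

(** The orientation-reversing substitution [x = - z * t]. It turns an integral over initial
    positions into one along the shock line. *)
Lemma Rintegral_scale_neg (k : R -> R) (M z : R) : continuous k -> 0 < M -> 0 < z ->
  (forall x, ~ `|x| <= M -> k x = 0) ->
  Rintegral leb1 setT (fun x : R => (x < 0)%R%:R * k x) =
  z * Rintegral leb1 setT (fun t : R => (0 < t)%R%:R * k (- z * t)).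
Proof.
(* [N] satisfies [z * N = M + z > M], so truncating at [t = N], that is at [x = - z * N], stays
   outside the support. *)
move=> ck M0 z0 kM; pose N := M / z + 1.
have N0 : 0 < N by rewrite /N addr_gt0 // divr_gt0.
have zN : z * N = M + z by rewrite /N mulrDr mulr1 mulrCA divff ?mulr1 // gt_eqF.
have cF : continuous (fun t : R => - z * t) by exact: mulrl_continuous.
have ckF : continuous (fun t : R => k (- z * t)).
  by move=> t; apply: (continuous_comp (@cF t)); exact: ck.
have F' : derive1 (fun t : R => - z * t) = cst (- z).
  apply/funext => t; rewrite derive1E.
  have -> : (fun t : R => - z * t) = - z *: (@id R) by [].
  by rewrite deriveZ ?derive_id //=; rewrite /GRing.scale /= mulr1.
rewrite (Rintegral_ind (A := `[- z * N, 0[%classic)); last first.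
  move=> x; have [xL|xL] := leP (- z * N) x.
    by left; rewrite mem_setE in_itv /= xL.
  by right; apply: kM => h; have := ler_norm (- x); rewrite normrN; lra.
rewrite (Rintegral_ind (A := `]0, N]%classic)); last first.
  move=> x; have [xL|xL] := leP x N.
    by left; rewrite mem_setE in_itv /= xL andbT.
  right; apply: kM => h; have h2 : z * N < z * x by rewrite ltr_pM2l.
  by have := ler_norm (- (- z * x)); rewrite normrN; lra.
rewrite /leb1 Rintegral_itv_bndo_bndc; last first.
  apply: integrableS (continuous_integrable_itv (- z * N) 0 ck) => //.
  exact: subset_itv_co_cc.
rewrite Rintegral_itv_obnd_cbnd; last first.
  apply: integrableS (continuous_integrable_itv 0 N ckF) => //.
  exact: subset_itv_oc_cc.
rewrite -RintegralZl //; last exact: continuous_integrable_itv.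
rewrite /Rintegral; congr fine.
have := @integration_by_substitution_decreasing _ (fun t : R => - z * t) k 0 N.
rewrite mulr0 => -> //.
- by apply: eq_integral => t _; rewrite F' /= !fctE /= opprK mulrC.
- exact: ltW.
- by move=> x y _ _ xy; rewrite !mulNr ltrN2 ltr_pM2l.
- by rewrite F' => ? _; exact: cvg_cst.
- by rewrite F'; apply: is_cvg_cst.
- by rewrite F'; apply: is_cvg_cst.
- split; first by move=> x _; exact: derivableM.
    exact/cvg_at_right_filter/cF.
  exact/cvg_at_left_filter/cF.
- exact: continuous_subspaceT.
Qed.

Lemma measurable_ind d (T : measurableType d) (P : T -> bool) : measurable_fun setT P ->
  measurable_fun setT (fun X => (P X)%:R : R).
Proof. by move=> mP; apply: (measurableT_comp (f := fun b : bool => b%:R : R)). Qed.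

Lemma bcs_ind (P : pt R -> bool) (f : pt R -> R) : measurable_fun setT P -> bcs f ->
  bcs (fun X => (P X)%:R * f X).
Proof.
move=> mP bf; have := bcsM bf (measurable_ind mP).
under [in X in _ -> X]eq_fun do rewrite mulrC.
by apply; exists 1 => X; case: (P X); rewrite ?normr1 ?normr0.
Qed.

Lemma cont2_line (f : pt R -> R) (a b c d : R) : cont2 f ->
  continuous (fun t : R => f (a * t + b, c * t + d)).
Proof.
move=> /cont2P cf t.
have h (p q : R) : continuous (fun t : R => p * t + q).
  by move=> u; apply: cvgD; [exact: mulrl_continuous|exact: cvg_cst].
apply: (@continuous_comp _ _ _ (fun t : R => (a * t + b, c * t + d)) (f : R * R -> R)); last exact: cf.
exact: (cvg_pair (h a b t) (h c d t)).
Qed.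

Lemma cont2_t (f : pt R -> R) (x : R) : cont2 f -> continuous (fun t : R => f (t, x)).
Proof.
move=> /(@cont2_line _ 1 0 0 x); rewrite (_ : (fun t => f (_, _)) = (fun t => f (t, x))) //.
by apply/funext => t; rewrite mul1r addr0 mul0r add0r.
Qed.

Lemma cont2_x (f : pt R -> R) (t : R) : cont2 f -> continuous (fun x : R => f (t, x)).
Proof.
move=> /(@cont2_line _ 0 t 1 0); rewrite (_ : (fun x => f (_, _)) = (fun x => f (t, x))) //.
by apply/funext => x; rewrite mul1r addr0 mul0r add0r.
Qed.

(** Bounded support is assumed of [phi] only. For a point outside the square, either the coordinate
    of differentiation is too large and [derive_supp] applies, or the whole line of differentiation
    misses the support and the derivative is that of a constant. *)
Lemma C10_bcs (phi phit phix : pt R -> R) : C10 phi phit phix ->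
  [/\ bcs phi, bcs phit & bcs phix].
Proof.
move=> [sp [cp [ct [cx [dt dx]]]]]; have [M M0 pM] := sp.
have NM (X : pt R) : ~ bsquare M X -> ~ (`|X.1| <= M) \/ ~ (`|X.2| <= M).
  by move=> h; apply/not_andP.
split; [exact: cont2_bcs| |]; apply: cont2_bcs => //; exists M => // -[t x] /NM /= [h|h].
- apply: (@derive_supp _ (fun s => phi (s, x)) (fun s => phit (s, x)) M (fun s => dt (s, x)) _ t h) => s hs.
  by apply: pM => -[].
- have := dt (t, x) => /= d; have <- : 'D_1 (fun s => phi (s, x)) t = phit (t, x) by apply: derive_val.
  rewrite (_ : (fun s => phi (s, x)) = cst 0) ?derive_cst //.
  by apply/funext => s; apply: pM => -[].
- have := dx (t, x) => /= d; have <- : 'D_1 (fun y => phi (t, y)) x = phix (t, x) by apply: derive_val.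
  rewrite (_ : (fun y => phi (t, y)) = cst 0) ?derive_cst //.
  by apply/funext => s; apply: pM => -[].
- apply: (@derive_supp _ (fun s => phi (t, s)) (fun s => phix (t, s)) M (fun s => dx (t, s)) _ x h) => s hs.
  by apply: pM => -[].
Qed.

Lemma Rintegral_indZ (b : bool) (P : R -> bool) (f : R -> R) :
  Rintegral leb1 setT (fun x => (b && P x)%:R * f x) =
  b%:R * Rintegral leb1 setT (fun x => (P x)%:R * f x).
Proof.
case: b => /=; first by rewrite mul1r.
rewrite mul0r; transitivity (Rintegral leb1 set0 f); last exact: Rintegral_set0.
by apply: (@Rintegral_ind _ set0 xpred0) => x; left; rewrite in_set0.
Qed.

Variables (phi phit phix : pt R -> R).
Hypothesis C : C10 phi phit phix.

Let J (z : R) := Rintegral leb1 setT (fun t : R => (0 < t)%R%:R * phi (t, - z * t)).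

Lemma measurable_Omega_lt (a : R) :
  measurable_fun setT (fun X : pt R => (0 < X.1) && (X.2 < a * X.1)).
Proof.
apply: measurable_and; apply: measurable_fun_ltr => //.
by apply: measurable_funM.
Qed.

Lemma measurable_Omega_ge (a : R) :
  measurable_fun setT (fun X : pt R => [&& 0 < X.1, X.2 < 0 & a * X.1 <= X.2]).
Proof.
apply: measurable_and; first exact: measurable_fun_ltr.
apply: measurable_and; first exact: measurable_fun_ltr.
by apply: measurable_fun_ler => //; apply: measurable_funM.
Qed.

Lemma wedge_dx (z : R) :
  Rintegral leb2 setT (fun X : pt R => ((0 < X.1) && (X.2 < - z * X.1))%R%:R * phix X) = J z.
Proof.
have [bp bt bx] := C10_bcs C; move: C => [_ [_ [_ [cx [_ dx]]]]].
have [_ [_ [M M0 pM]]] := bp.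
rewrite leb2_fubini_tx; last by apply: bcs_ind => //; exact: measurable_Omega_lt.
apply: eq_Rintegral => t _ /=; rewrite Rintegral_indZ.
congr *%R; apply: (@Rintegral_derive_lt _ (fun x => phi (t, x)) _ M).
- by move=> x; exact: (dx (t, x)).
- exact: cont2_x.
- by move=> x h; apply: pM => -[].
Qed.

Lemma Omega_dt :
  Rintegral leb2 setT (fun X : pt R => ((0 < X.1) && (X.2 < 0))%R%:R * phit X) =
  - Rintegral leb1 setT (fun x : R => (x < 0)%R%:R * phi (0, x)).
Proof.
have [bp bt bx] := C10_bcs C; move: C => [_ [_ [ct [_ [dt _]]]]].
have [_ [_ [M M0 pM]]] := bp.
rewrite leb2_fubini_xt; last first.
  have := @measurable_Omega_lt 0; under eq_fun do rewrite mul0r.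
  by move=> h; exact: bcs_ind.
rewrite -mulN1r -RintegralZl //; last first.
  apply: bcs1_integrable; have := bcs_pairt 0 (bcs_ind (P := fun X => X.2 < 0) _ bp); apply.
  exact: measurable_fun_ltr.
apply: eq_Rintegral => x _ /=; under eq_fun do rewrite andbC.
rewrite Rintegral_indZ mulN1r -mulrN; congr *%R.
apply: (@Rintegral_derive_gt _ (fun s => phi (s, x)) _ M).
- by move=> t; exact: (dt (t, x)).
- exact: cont2_t.
- by move=> s h; apply: pM => -[].
Qed.

(** Integrating in [t] first, from the moment [- x / z] at which the shock reaches [x], leaves a
    trace parametrised by [x]; returning to the parameter [t] produces the factor [z]. *)
Lemma wedge_dt (z : R) : 0 < z ->
  Rintegral leb2 setT (fun X : pt R => [&& 0 < X.1, X.2 < 0 & - z * X.1 <= X.2]%R%:R * phit X) =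
  - z * J z.
Proof.
move=> z0; have [bp bt bx] := C10_bcs C; move: C => [_ [cp [ct [_ [dt _]]]]].
have [_ [_ [M M0 pM]]] := bp.
rewrite leb2_fubini_xt; last by apply: bcs_ind => //; exact: measurable_Omega_ge.
have ck : continuous (fun x : R => phi (- x / z, x)).
  have := @cont2_line _ (- z^-1) 0 1 0 cp.
  rewrite (_ : (fun t => _) = (fun x : R => phi (- x / z, x))) //.
  by apply/funext => x; rewrite !addr0 mul1r mulNr mulrC mulNr.
have kM x : ~ `|x| <= M -> phi (- x / z, x) = 0 by move=> h; apply: pM => -[].
(* The trace is written as a function of [x = - z * t] alone, the shape to which the substitution
   applies. *)
have -> : J z = Rintegral leb1 setT (fun t : R => (0 < t)%R%:R * phi (- (- z * t) / z, - z * t)).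
  apply: eq_Rintegral => t _; congr (_ * phi (_, _)).
  by rewrite !mulNr opprK mulrC mulKf // gt_eqF.
rewrite mulNr -(Rintegral_scale_neg ck M0 z0 kM) -mulN1r -RintegralZl //; last first.
  apply: bcs1_integrable; split.
    apply: measurable_funM; last exact: continuous_measurable_fun.
    by apply: measurable_ind; exact: measurable_fun_ltr.
  split; last by exists M => // x h; rewrite kM // mulr0.
  have [_ [[D pD] _]] := bp; exists D => x; case: (x < 0); rewrite ?mul1r // mul0r normr0.
  by rewrite (le_trans _ (pD (0, 0))).
apply: eq_Rintegral => x _ /=; rewrite mulN1r -mulrN.
(* For [x < 0] the bound [t >= - x / z] already forces [t > 0], so the indicator splits into a
   factor in [x] and a half-line in [t]. *)
have -> : (fun t => [&& 0 < t, x < 0 & - z * t <= x]%R%:R * phit (t, x)) =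
   (fun t => ((x < 0) && (- x / z <= t))%R%:R * phit (t, x)).
  apply/funext => t; congr (_%:R * _); rewrite ler_pdivrMr //.
  case: (ltP x 0) => x0 /=; last by rewrite andbF.
  case: (ltP 0 t) => t0 /=; first by rewrite mulNr lerNl mulrC.
  suff /negbTE -> : ~~ (- x <= t * z) by [].
  by rewrite -ltNge; have := ler_wpM2r (ltW z0) t0; lra.
rewrite Rintegral_indZ; congr *%R.
apply: (@Rintegral_derive_ge _ (fun s => phi (s, x)) _ M).
- by move=> t; exact: (dt (t, x)).
- exact: cont2_t.
- by move=> s h; apply: pM => -[].
Qed.

End wedge.

(** * Measures with densities *)

Section density.
Local Open Scope ereal_scope.
Context d (T : measurableType d) (R : realType) (mu : {measure set T -> \bar R}).
Variable f : T -> R.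
Hypotheses (mf : measurable_fun setT f) (f0 : forall x, (0 <= f x)%R).

Lemma dens_funE : dens_fun f = EFin \o f.
Proof. by apply/funext => x; rewrite /dens_fun asboolT. Qed.

Lemma dmeasE A : dmeas mu f A = \int[mu]_(x in A) (f x)%:E.
Proof. by rewrite /dmeas dens_funE. Qed.

Import HBNNSimple.

Let mEf : measurable_fun setT (EFin \o f).
Proof. exact/measurable_EFinP. Qed.

Let integral_dmeas_nnsfun (h : {nnsfun T >-> R}) :
  \int[dmeas mu f]_x (h x)%:E = \int[mu]_x ((f x)%:E * (h x)%:E).
Proof.
under [RHS]eq_integral.
  move=> x xD; rewrite fimfunE -fsumEFin// ge0_mule_fsumr; last first.
    by move=> r; rewrite EFinM nnfun_muleindic_ge0.
  over.
rewrite [RHS]ge0_integral_fsum//; last 2 first.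
  - move=> r; apply: emeasurable_funM => //; apply/measurable_EFinP.
    by apply: measurable_funM => //; exact: measurable_indic.
  - move=> n x _; apply: mule_ge0; first by rewrite lee_fin.
    by rewrite EFinM nnfun_muleindic_ge0.
rewrite integralT_nnsfun sintegralE; apply: eq_fsbigr => r _.
rewrite [X in _ * X](_ : _ = \int[mu]_(x in h @^-1` [set r]) (f x)%:E); last exact: dmeasE.
rewrite integral_mkcond.
(* A negative [r] has an empty fibre; otherwise [r] is a nonnegative constant and may leave the
   integral. *)
case: (pselect (0 <= r)%R) => r0; last first.
  have -> : h @^-1` [set r] = set0.
    by apply/preimage_nnfun0; rewrite ltNge; apply/negP.
  under eq_integral do rewrite patch_set0.
  rewrite integral0 mule0; apply/esym/integral0_eq => x _.
  by rewrite indicE in_set0 mulr0 mule0.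
under [in RHS]eq_integral do rewrite EFinM muleCA.
rewrite ge0_integralZl //; last 2 first.
- by apply: emeasurable_funM => //; apply/measurable_EFinP; exact: measurable_indic.
- by move=> x _; rewrite mule_ge0 // lee_fin.
congr (_ * _); apply: eq_integral => x _; rewrite /patch indicE.
by case: ifP => _; rewrite ?mule1 ?mule0.
Qed.

(** Simple functions first, then monotone convergence on both sides; nonnegativity of [f] keeps the
    products with the approximations increasing. *)
Lemma ge0_integral_dmeas (g : T -> \bar R) : measurable_fun setT g ->
  (forall x, 0 <= g x) ->
  \int[dmeas mu f]_x g x = \int[mu]_x ((f x)%:E * g x).
Proof.
move=> mg g0; pose g_ := nnsfun_approx measurableT mg.
have cvgg x : (g_ n x)%:E @[n --> \oo] --> g x.
  by apply: cvg_nnsfun_approx.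
transitivity (limn (fun n => \int[dmeas mu f]_x (g_ n x)%:E)).
  rewrite -monotone_convergence//=.
  - by apply: eq_integral => x _; apply/esym/cvg_lim.
  - by move=> n; apply/measurable_EFinP.
  - by move=> n x _; rewrite lee_fin.
  - by move=> x _ a b ab; rewrite lee_fin//; exact/lefP/nd_nnsfun_approx.
under eq_fun do rewrite integral_dmeas_nnsfun.
rewrite -monotone_convergence//=.
- apply: eq_integral => x _; apply/cvg_lim => //.
  by apply: cvgeZl.
- by move=> n; apply: emeasurable_funM => //; exact/measurable_EFinP.
- by move=> n x _; rewrite mule_ge0 // lee_fin.
- move=> x _ a b ab; apply: lee_wpmul2l; first by rewrite lee_fin.
  by rewrite lee_fin; exact/lefP/nd_nnsfun_approx.
Qed.

End density.

Section density_real.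
Context d (T : measurableType d) (R : realType) (mu : {measure set T -> \bar R}).
Variable f : T -> R.
Hypotheses (mf : measurable_fun setT f) (f0 : forall x, 0 <= f x).

(** Multiplication by a nonnegative [f] commutes with taking positive and negative parts, so the
    nonnegative case applies to each part. *)
Lemma integral_dmeas (g : T -> R) : measurable_fun setT g ->
  (\int[dmeas mu f]_x (g x)%:E = \int[mu]_x (f x * g x)%:E)%E.
Proof.
move=> mg; have mEg : measurable_fun setT (EFin \o g) by exact/measurable_EFinP.
rewrite (integralE (dmeas mu f)) (integralE mu).
rewrite !ge0_integral_dmeas //; [|exact: measurable_funeneg|exact: measurable_funepos].
congr (_ - _)%E; apply: eq_integral => x _.
  by rewrite !funeposE -!EFin_max -EFinM maxr_pMr // mulr0.
by rewrite !funenegE -!EFinN -!EFin_max -EFinM maxr_pMr // mulrN mulr0.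
Qed.

Lemma dmeas_lty (A : set T) (C : R) : measurable A -> (mu A < +oo)%E ->
  (forall x, A x -> f x <= C) -> (dmeas mu f A < +oo)%E.
Proof.
move=> mA muA fC; rewrite dmeasE //.
have [->|/set0P[x0 Ax0]] := eqVneq A set0; first by rewrite integral_set0.
apply: (@le_lt_trans _ _ (\int[mu]_(x in A) C%:E)%E).
  apply: ge0_le_integral => //.
  - by move=> x _; rewrite lee_fin.
  - by apply/measurable_EFinP; exact: measurable_funS mf.
by rewrite integral_cst // lte_mul_pinfty // lee_fin (le_trans (f0 x0)) // fC.
Qed.

End density_real.

(** * Measures with an area density and a line density on the piston *)

Section DL_theory.
Context {R : realType}.

(* The density of [lmeas g] on the whole time axis. *)
Definition half_weight (g : R -> R) : measurableTypeR R -> R :=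
  fun t => if 0 <= t then g t else 0.

(** Only local boundedness is asked, in contrast to [density_ok]: the piston weights of interest
    grow linearly in time. *)
Definition weight_ok (g : R -> R) :=
  measurable_fun setT (half_weight g) /\ (forall t, 0 <= half_weight g t) /\
  (forall K, exists C, forall t, `|t| <= K -> half_weight g t <= C).

Definition density_ok (f : pt R -> R) :=
  measurable_fun setT f /\ (forall X, 0 <= f X) /\ (exists C, forall X, f X <= C).

Lemma measurable_emb_P : measurable_fun setT (@emb_P R).
Proof. by apply: measurable_fun_pair => //; exact: measurable_cst. Qed.

Variables (f : pt R -> R) (g : R -> R).
Hypotheses (fok : density_ok f) (gok : weight_ok g).

Lemma radon_dmeas : radon (dmeas leb2 f).
Proof.
move=> M M0; have [mf [f0 [C fC]]] := fok.
apply: (dmeas_lty mf f0 (C := C)) => //; first exact: measurable_bsquare.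
exact: radon_leb2.
Qed.

Lemma radon_lmeas : radon (lmeas g).
Proof.
move=> M M0; have [mg [g0 /(_ M) [C gC]]] := gok.
rewrite /= /lmeas /pushforward.
apply: (@le_lt_trans _ _ (dmeas leb1 (half_weight g) `[- M, M]%classic)).
  apply: le_measure; rewrite ?inE //.
    rewrite -[X in measurable X]setTI; apply: measurable_emb_P => //.
    exact: measurable_bsquare.
  by move=> t [/= + _]; rewrite in_itv /= ler_norml.
apply: (dmeas_lty mg g0 (C := C)) => //.
  have h : - M <= M by lra.
  by rewrite (leb1_itv _ _ h) ltry.
by move=> t; rewrite /= in_itv /= -ler_norml; exact: gC.
Qed.

Lemma DLE (A : set (pt R)) : DL f g A = (dmeas leb2 f A + lmeas g A)%E.
Proof. exact: measure_addE. Qed.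

Lemma radon_DL : radon (DL f g).
Proof.
move=> M M0; rewrite DLE lte_add_pinfty //.
  exact: radon_dmeas.
exact: radon_lmeas.
Qed.

Lemma Rintegral_DL (phi : pt R -> R) : bcs phi ->
  Rintegral (DL f g) setT phi =
  Rintegral leb2 setT (fun X => f X * phi X) +
  Rintegral leb1 setT (fun t => half_weight g t * phi (t, 0)).
Proof.
move=> bp; have [mf [f0 [C fC]]] := fok; have [mg [g0 gC]] := gok.
have [mp [[D pD] _]] := bp.
have i1 : (dmeas leb2 f).-integrable setT (EFin \o phi).
  by apply: bcs_integrable => //; exact: radon_dmeas.
have i2 : (lmeas g).-integrable setT (EFin \o phi).
  by apply: bcs_integrable => //; exact: radon_lmeas.
rewrite /Rintegral /DL integral_measure_add //.
rewrite fineD; [|exact: integrable_fin_num..].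
congr (fine _ + fine _); first exact: integral_dmeas.
rewrite /lmeas integral_pushforward //.
- have mpe : measurable_fun setT (phi \o @emb_P R).
    by apply: measurableT_comp => //; exact: measurable_emb_P.
  by rewrite preimage_setT; exact: (integral_dmeas _ mg g0 mpe).
- exact: measurable_emb_P.
- exact/measurable_EFinP.
- rewrite preimage_setT; have [_ [_ [M M0 pM]]] := bp.
  have h : - M <= M by lra.
  apply: (@bfs_integrable R _ (measurableTypeR R) (dmeas leb1 (half_weight g))
    (`[- M, M]%classic : set R) (phi \o @emb_P R) D) => //.
  + have [E hE] := gC M; apply: (dmeas_lty mg g0 (C := E)) => //.
      by rewrite leb1_itv // ltry.
    by move=> t; rewrite /= in_itv /= -ler_norml; exact: hE.
  + by apply: measurableT_comp => //; exact: measurable_emb_P.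
  + by move=> t; exact: pD.
  + move=> t ht; apply: pM => -[/= + _]; rewrite ler_norml => h'.
    by apply: ht; rewrite /= in_itv.
Qed.

Lemma spair_DLs (phi : pt R -> R) : bcs phi ->
  spair (DLs f g) phi = Rintegral leb2 setT (fun X => f X * phi X) +
  Rintegral leb1 setT (fun t => half_weight g t * phi (t, 0)).
Proof.
move=> bp; rewrite /spair /= Rintegral_DL //.
by rewrite [X in _ - X]/Rintegral integral_measure_zero subr0.
Qed.

Lemma bnd_pos (A : set (pt R)) : bnd A -> exists2 M : R, 0 < M & A `<=` bsquare M.
Proof.
move=> [M AM]; exists (Num.max M 1); first by rewrite lt_max ltr01 orbT.
move=> X /AM [h1 h2]; split; rewrite le_max ?h1 ?h2 //.
Qed.

Lemma bcs_indic (A : set (pt R)) : measurable A -> bnd A -> bcs (\1_A : pt R -> R).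
Proof.
move=> mA /bnd_pos[M M0 AM]; split; first exact: measurable_indic.
split; first by exists 1 => X; rewrite indicE; case: (_ \in _); rewrite ?normr1 ?normr0.
exists M => // X XM; rewrite indicE memNset // => /AM; exact: XM.
Qed.

Lemma DL_lty (A : set (pt R)) : measurable A -> bnd A -> (DL f g A < +oo)%E.
Proof.
move=> mA /bnd_pos[M M0 AM]; apply: le_lt_trans (radon_DL M0).
by apply: le_measure; rewrite ?inE //; exact: measurable_bsquare.
Qed.

Lemma sval_DLs_fine (A : set (pt R)) : Defs.sval (DLs f g) A = fine (DL f g A).
Proof. by rewrite /Defs.sval /= /mzero /= subr0. Qed.

Lemma sval_DLs (A : set (pt R)) : measurable A -> bnd A ->
  Defs.sval (DLs f g) A = Rintegral leb2 setT (fun X => f X * \1_A X) +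
  Rintegral leb1 setT (fun t => half_weight g t * \1_A (t, 0)).
Proof.
move=> mA bA; rewrite sval_DLs_fine -Rintegral_DL; last exact: bcs_indic.
by rewrite /Rintegral integral_indic // setIT.
Qed.

Lemma sradon_DLs : sradon (DLs f g).
Proof. by split; [exact: radon_DL|move=> M M0; rewrite /= /mzero ltry]. Qed.

Lemma snonneg_DLs : snonneg (DLs f g).
Proof. by move=> A _ _; rewrite sval_DLs_fine fine_ge0. Qed.

Lemma supp_DLs : (forall X, ~ Omegab X -> f X = 0) -> supp_Ob (DLs f g).
Proof.
move=> fO; have [mf [f0 _]] := fok; have [mg [g0 _]] := gok.
split; last by [].
rewrite /= DLE.
rewrite [X in (X + _)%E](_ : _ = 0%E); last first.
  by apply: etrans (dmeasE _ mf f0 _) _; apply: integral0_eq => X /fO ->.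
rewrite add0e; apply: etrans (dmeasE _ mg g0 _) _; apply: integral0_eq => t /= h.
rewrite /half_weight; case: ifPn => // t0; exfalso; apply: h.
by split=> /=.
Qed.

End DL_theory.

(** * Radon-Nikodym derivatives between such measures *)

Section sdens_theory.
Context {R : realType}.

(** The area part and the line part are compared separately, so the actual values of [u] on the
    piston matter wherever [g] charges it. This is what distinguishes velocity from energy in the
    singular solution. *)
Lemma sdens_DLs (f f' u : pt R -> R) (g g' : R -> R) :
  density_ok f -> weight_ok g -> density_ok f' -> weight_ok g' ->
  measurable_fun setT u -> (exists C : R, forall X, `|u X| <= C) ->
  (forall X, f' X = f X * u X) -> (forall t, 0 <= t -> g' t = g t * u (t, 0)) ->
  sdens (DLs f' g') u (DLs f g).
Proof.
move=> fok gok f'ok g'ok mu uC ff gg A mA bA.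
have b1 := bcs_indic mA bA.
have bu : bcs (fun X => \1_A X * u X) by exact: bcsM.
have e : u \_ A = (fun X => \1_A X * u X).
  by apply/funext => X; rewrite /patch indicE; case: ifP => _; rewrite ?mul1r ?mul0r.
split.
  apply/(integrable_mkcond _ mA); rewrite restrict_EFin e.
  by apply: bcs_integrable => //; exact: radon_DL.
split.
  apply/(integrable_mkcond _ mA); rewrite restrict_EFin e.
  by apply: bcs_integrable => // M M0; rewrite /= /mzero ltry.
rewrite sval_DLs // [X in _ - X]/Rintegral integral_measure_zero subr0.
rewrite [RHS]Rintegral_mkcond e /= Rintegral_DL //.
congr (_ + _); apply: eq_Rintegral => X _; first by rewrite ff -mulrA (mulrC (u X)).
rewrite /half_weight; case: ifPn => t0; last by rewrite !mul0r.
by rewrite gg // -mulrA (mulrC (u _)).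
Qed.

Lemma weight_ok0 : weight_ok (fun _ : R => 0).
Proof.
have e : half_weight (fun _ : R => 0) = cst 0.
  by apply/funext => t; rewrite /half_weight if_same.
by rewrite /weight_ok e; split; [exact: measurable_cst|split=> // K; exists 0].
Qed.

Lemma weight_ok_lin (c : R) : 0 <= c -> weight_ok (fun t : R => c * t).
Proof.
move=> c0; split; last split.
- apply: measurable_fun_ifT => //; first exact: measurable_fun_ler.
  by apply: measurable_funM.
- by move=> t; rewrite /half_weight; case: ifP => // t0; exact: mulr_ge0.
- move=> K; exists (c * `|K|) => t tK; rewrite /half_weight; case: ifP => t0.
    apply: ler_wpM2l => //; apply: le_trans (ler_norm _) _.
    exact: le_trans tK (ler_norm _).
  exact: mulr_ge0.
Qed.

Lemma spair_DLs0 (f phi : pt R -> R) : density_ok f -> bcs phi ->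
  spair (DLs f (fun _ => 0)) phi = Rintegral leb2 setT (fun X => f X * phi X).
Proof.
move=> fok bp; rewrite spair_DLs //; last exact: weight_ok0.
rewrite [X in _ + X](_ : _ = 0) ?addr0 // /Rintegral.
by rewrite integral0_eq // => t _; rewrite /half_weight if_same mul0r.
Qed.

Lemma sval_DLs_off (f : pt R -> R) (g : R -> R) (A : set (pt R)) :
  density_ok f -> weight_ok g -> measurable A -> bnd A ->
  (forall t, 0 <= t -> g t = 0 \/ ~ A (t, 0)) ->
  Defs.sval (DLs f g) A = Rintegral leb2 A f.
Proof.
move=> fok gok mA bA hA; rewrite sval_DLs // [X in _ + X](_ : _ = 0).
  rewrite addr0 [RHS]Rintegral_mkcond; apply: eq_Rintegral => X _.
  by rewrite /patch indicE; case: ifP; rewrite ?mulr1 ?mulr0.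
rewrite /Rintegral integral0_eq // => t _; rewrite /half_weight; case: ifP => t0.
  case: (hA t t0) => [->|h]; first by rewrite mul0r.
  by rewrite indicE memNset // mulr0.
by rewrite mul0r.
Qed.

End sdens_theory.

(** * Jump points *)

Section almost_everywhere.
Context {R : realType}.
Implicit Types (O N S : set (pt R)) (f dr : pt R -> R).

Import HBNNSimple.

(** The integral is a supremum over simple functions below [h], and [c] times the indicator of [S]
    is one of them. The argument suits the jump condition, where the distance to a limit state is
    formed from an arbitrary function [U]. *)
Lemma integral_lower_bound (D S : set (pt R)) (h : pt R -> R) (c : R) : measurable S ->
  S `<=` D -> (forall X, 0 <= h X) -> 0 <= c -> (forall X, S X -> c <= h X) ->
  (c%:E * leb2 S <= \int[leb2]_(X in D) (h X)%:E)%E.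
Proof.
move=> mS SD h0 c0 ch; rewrite ge0_integralE; last by move=> X _; rewrite lee_fin.
apply: ereal_sup_ubound => /=.
pose hS := scale_nnsfun (indic_nnsfun R mS) c0.
have hSE X : hS X = c * \1_S X by [].
exists hS.
  move=> X; rewrite hSE /patch indicE.
  have [XS|XS] := boolP (X \in S); last first.
    by rewrite mulr0; case: ifP => _; rewrite lee_fin.
  rewrite mulr1; have XS' : S X by exact: set_mem.
  by rewrite mem_set ?lee_fin; [exact: ch|exact: SD].
transitivity (sintegral leb2 (cst c \* (indic_nnsfun R mS : pt R -> R))); first by [].
by rewrite sintegralrM sintegral_indic.
Qed.

Lemma bnd_square (X : pt R) (r : R) : bnd (square X r).
Proof.
exists (`|X.1| + `|X.2| + r) => Y [h1 h2].
have r0 : 0 <= r by apply: ltW; apply: le_lt_trans h1.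
have := ler_normD (Y.1 - X.1) X.1; have := ler_normD (Y.2 - X.2) X.2.
rewrite !subrK => k1 k2; have := normr_ge0 X.1; have := normr_ge0 X.2.
by split; lra.
Qed.

Lemma density_ok_integrable f A : density_ok f -> measurable A -> bnd A ->
  leb2.-integrable A (EFin \o f).
Proof.
move=> [mf [f0 [C fC]]] mA bA.
apply/(integrable_mkcond _ mA).
have b1 := bcs_indic mA bA.
have : bcs (fun X => \1_A X * f X).
  by apply: bcsM => //; exists C => X; rewrite ger0_norm.
move=> /(bcs_integrable radon_leb2); congr (leb2.-integrable _ _).
by apply/funext => X; rewrite /patch /= indicE; case: ifP; rewrite ?mul1r ?mul0r.
Qed.

Lemma ae_eq_square f dr (X : pt R) (r : R) : density_ok f ->
  (forall A, measurable A -> bnd A -> A `<=` square X r ->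
    leb2.-integrable A (EFin \o dr) /\ Rintegral leb2 A dr = Rintegral leb2 A f) ->
  exists N, [/\ measurable N, leb2 N = 0%E &
    forall Y, square X r Y -> ~ N Y -> dr Y = f Y].
Proof.
move=> fok H.
have mS := measurable_square X r.
have [mf _] := fok.
have : ae_eq leb2 (square X r) (EFin \o dr) (EFin \o f).
  apply: integral_ae_eq => //.
  - by have [] := H _ mS (bnd_square _ _) (subset_refl _).
  - by apply/measurable_EFinP; exact: measurable_funS mf.
  - move=> A AS mA.
    have bA : bnd A.
      by have [M SM] := bnd_square X r; exists M => Y /AS /SM.
    have [id e] := H _ mA bA AS.
    have if_ := density_ok_integrable fok mA bA.
    have /= F1 := integrable_fin_num mA id; have /= F2 := integrable_fin_num mA if_.
    by rewrite /= -(fineK F1) -(fineK F2); congr EFin.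
move=> [N [mN N0 hN]]; exists N; split=> // Y SY NY.
apply: contrapT => ne; apply: NY; apply: hN => /= /(_ SY) [].
by move/ne.
Qed.

(** The integrals are compared on bounded sets only, so the squares of a countable cover are treated
    one at a time and their exceptional sets united. *)
Lemma ae_eq_open O f dr : openS O -> density_ok f ->
  (forall A, measurable A -> bnd A -> A `<=` O ->
    leb2.-integrable A (EFin \o dr) /\ Rintegral leb2 A dr = Rintegral leb2 A f) ->
  exists N, [/\ measurable N, leb2 N = 0%E & forall Y, O Y -> ~ N Y -> dr Y = f Y].
Proof.
move=> oO fok H; have [c [r [sub OE]]] := openS_cover oO.
have /choice[N hN] : forall n, exists N, [/\ measurable N, leb2 N = 0%E &
    forall Y, square (c n) (r n) Y -> ~ N Y -> dr Y = f Y].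
  move=> n; apply: ae_eq_square => // A mA bA AS; apply: H => //.
  exact: subset_trans AS (sub n).
have mN n : measurable (N n) by case: (hN n).
exists (\bigcup_n N n); split.
- exact: bigcupT_measurable.
- have /negligibleP : leb2.-negligible (\bigcup_n N n).
    apply: negligible_bigcup => n; apply/negligibleP => //.
    by case: (hN n).
  by apply; exact: bigcupT_measurable.
- move=> Y; rewrite OE => -[n _ Yn] YN; have [_ _] := hN n; apply => // NY.
  by apply: YN; exists n.
Qed.

End almost_everywhere.

(** * Identification of speed and states at an approximate jump *)

Section jump.
Context {R : realType}.
Implicit Types (U : pt R -> R * R * R) (X Y : pt R) (s r a b k : R).

Lemma dist3_ge0 (V W : R * R * R) : 0 <= dist3 V W.
Proof. by rewrite /dist3 !addr_ge0. Qed.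

Lemma dist3_eq0 (V W : R * R * R) : dist3 V W = 0 -> V = W.
Proof.
move: V W => [[v1 v2] v3] [[w1 w2] w3]; rewrite /dist3 /= => h.
have := normr_ge0 (v1 - w1); have := normr_ge0 (v2 - w2); have := normr_ge0 (v3 - w3).
move=> h3 h2 h1; congr (_, _, _); apply/eqP; rewrite -subr_eq0 -normr_eq0; apply/eqP; lra.
Qed.

(** The square centred at [X + r (a, b)] with half-side [r * k]: it scales with [r], so its area is
    a fixed multiple of [r ^+ 2], the order against which one-sided limits are measured. *)
Definition cell X r a b k : set (pt R) := square (X.1 + r * a, X.2 + r * b) (r * k).

(** In units of [r], moving each coordinate by at most [k] changes [x - s t] by at most
    [k * (1 + |s|)]; with this margin at the centre the whole cell stays on one side of the line. *)
Lemma cone_lt X s r a b k Y : 0 < r -> b + k * (1 + `|s|) <= s * a ->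
  cell X r a b k Y -> Y.2 - X.2 < s * (Y.1 - X.1).
Proof.
move=> r0 h [/=]; set e := Y.1 - (_ + _) => he.
rewrite ltr_distl => /andP[_ h2].
have -> : Y.1 - X.1 = r * a + e by rewrite /e; lra.
have h4 : - (`|s| * (r * k)) <= s * e.
  have : `|s * e| <= `|s| * (r * k) by rewrite normrM ler_wpM2l // ltW.
  by rewrite ler_norml => /andP[].
have : r * (b + k * (1 + `|s|)) <= r * (s * a) by rewrite ler_pM2l.
by lra.
Qed.

Lemma cone_gt X s r a b k Y : 0 < r -> s * a + k * (1 + `|s|) <= b ->
  cell X r a b k Y -> s * (Y.1 - X.1) < Y.2 - X.2.
Proof.
move=> r0 h [/=]; set e := Y.1 - (_ + _) => he.
rewrite ltr_distl => /andP[h2 _].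
have -> : Y.1 - X.1 = r * a + e by rewrite /e; lra.
have h4 : s * e <= `|s| * (r * k).
  have : `|s * e| <= `|s| * (r * k) by rewrite normrM ler_wpM2l // ltW.
  by rewrite ler_norml => /andP[].
have : r * (s * a + k * (1 + `|s|)) <= r * b by rewrite ler_pM2l.
by lra.
Qed.

(** The hypothesis places the cell in the unit ball of the sum norm, which is contained in the
    Euclidean one. *)
Lemma cell_ball X r a b k Y : 0 < r -> 0 < k -> `|a| + `|b| + 2 * k <= 1 ->
  cell X r a b k Y ->
  (Y.1 - X.1) ^+ 2 + (Y.2 - X.2) ^+ 2 < r ^+ 2 /\ square X r Y.
Proof.
move=> r0 k0 h [/= h1 h2].
have n1 : `|Y.1 - X.1| < r * `|a| + r * k.
  have := ler_normD (Y.1 - (X.1 + r * a)) (r * a); rewrite normrM (gtr0_norm r0).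
  have -> : Y.1 - (X.1 + r * a) + r * a = Y.1 - X.1 by lra.
  by lra.
have n2 : `|Y.2 - X.2| < r * `|b| + r * k.
  have := ler_normD (Y.2 - (X.2 + r * b)) (r * b); rewrite normrM (gtr0_norm r0).
  have -> : Y.2 - (X.2 + r * b) + r * b = Y.2 - X.2 by lra.
  by lra.
have hr : r * (`|a| + `|b| + 2 * k) <= r * 1 by rewrite ler_pM2l.
have rk : 0 < r * k by exact: mulr_gt0.
have ra : 0 <= r * `|a| by rewrite mulr_ge0 // ltW.
have rb : 0 <= r * `|b| by rewrite mulr_ge0 // ltW.
have p1 := normr_ge0 (Y.1 - X.1); have p2 := normr_ge0 (Y.2 - X.2).
have hh : `|Y.1 - X.1| + `|Y.2 - X.2| < r by lra.
split; last by split; lra.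
rewrite -(real_normK (num_real (Y.1 - X.1))) -(real_normK (num_real (Y.2 - X.2))).
by nra.
Qed.

Definition one_sided U X s (side : bool) (V : R * R * R) :=
  forall e, 0 < e -> exists2 d, 0 < d & forall r, 0 < r < d ->
    (\int[leb2]_(Y in hball X s r side) (dist3 (U Y) V)%:E <= (e * r ^+ 2)%:E)%E.

(* If a fixed proportion of every small half-ball carries the constant state [V],
   then [V] is the one-sided limit. *)
Lemma one_sided_value U X s side (V0 V : R * R * R) (N : set (pt R)) a b k r0 :
  measurable N -> leb2 N = 0%E -> 0 < k -> 0 < r0 ->
  (forall r Y, 0 < r < r0 -> cell X r a b k Y -> hball X s r side Y) ->
  (forall r Y, 0 < r < r0 -> cell X r a b k Y -> ~ N Y -> U Y = V) ->
  one_sided U X s side V0 -> V = V0.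
Proof.
move=> mN N0 k0 r00 hb hU hV; apply: dist3_eq0; apply/eqP; apply/negPn/negP => ne.
have d0 : 0 < dist3 V V0 by rewrite lt_neqAle eq_sym ne dist3_ge0.
(* The cell has area [4 * k ^+ 2 * r ^+ 2], so it alone contributes four times this tolerance. *)
have e0 : 0 < k ^+ 2 * dist3 V V0 by rewrite mulr_gt0 // exprn_gt0.
have [d dpos hd] := hV _ e0.
pose r := Num.min d r0 / 2.
have m0 : 0 < Num.min d r0 by rewrite lt_min dpos.
have rpos : 0 < r by rewrite /r; lra.
have rd : r < d /\ r < r0.
  have : r < Num.min d r0 by rewrite /r; lra.
  by rewrite lt_min => /andP[].
have /hd : 0 < r < d by rewrite rpos; case: rd.
have rr : 0 < r < r0 by rewrite rpos; case: rd.
rewrite leNgt => /negP; apply.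
pose S := cell X r a b k `\` N.
have mc : measurable (cell X r a b k) by exact: measurable_square.
have mS : measurable S by exact: measurableD.
have SE : leb2 S = ((2 * (r * k)) ^+ 2)%:E.
  rewrite -(leb2_square (X.1 + r * a, X.2 + r * b)) ?mulr_gt0 //.
  apply/esym; apply: etrans (measureDI leb2 mc mN) _.
  rewrite [X in (_ + X)%E = _](_ : _ = 0%E) ?adde0 //.
  apply/eqP; rewrite eq_le measure_ge0 andbT -N0; apply: le_measure; rewrite ?inE //.
  exact: measurableI.
apply: lt_le_trans (integral_lower_bound (S := S) (c := dist3 V V0) mS _ _ (ltW d0) _).
- rewrite SE -EFinM lte_fin.
  have : 0 < r ^+ 2 * (k ^+ 2 * dist3 V V0) by rewrite mulr_gt0 // exprn_gt0.
  by rewrite !exprMn; lra.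
- by move=> Y [/(hb _ _ rr)].
- by move=> Y; exact: dist3_ge0.
- by move=> Y [cY NY]; rewrite (hU _ _ rr cY NY).
Qed.

Lemma openS_Omega : openS (@Omega R).
Proof.
move=> X [h1 h2]; exists (Num.min X.1 (- X.2)); first by rewrite lt_min h1 oppr_gt0.
move=> Y []; rewrite !lt_min => /andP[k1 _] /andP[_ k2].
by move: k1 k2; rewrite !ltr_distl => /andP[? _] /andP[_ ?]; split; lra.
Qed.

(** One [k] for the tested speed [s] and the true slope [s0]: cells centred straight to the left and
    right of the jump point, at distance [r / 2], then lie on the same side of both lines. *)
Lemma cell_constant (s s0 : R) : exists k, [/\ 0 < k, k <= 1 / 8,
  k * (1 + `|s|) <= 1 / 8 & k * (1 + `|s0|) <= 1 / 8].
Proof.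
have K1 : 1 <= 1 + `|s| + `|s0| by rewrite -addrA lerDl addr_ge0.
move: (normr_ge0 s) (normr_ge0 s0) K1; set K := 1 + `|s| + `|s0| => n1 n2 K1.
have K0 : 0 < K by exact: lt_le_trans K1.
pose k := (8 * K)^-1.
have k0 : 0 < k by rewrite invr_gt0 mulr_gt0.
have kK : k * K = 1 / 8 by rewrite /k; field; rewrite gt_eqF.
exists k; rewrite -kK; split; rewrite ?ler_pM2l //.
- by rewrite -[X in X <= _]mulr1 ler_pM2l.
- by rewrite /K lerDl.
- by rewrite /K -addrA lerD2l lerDr.
Qed.

(* The direction [(al, al * m)] points into the wedge between the lines of
   slopes [s] and [s0]. *)
Lemma wedge_constant (s s0 : R) : s != s0 -> exists al m k,
  [/\ 0 < k, `|al| + `|al * m| + 2 * k <= 1,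
      s0 * al + k * (1 + `|s0|) <= al * m & al * m + k * (1 + `|s|) <= s * al].
Proof.
move=> sne; have [n1 n2] := (normr_ge0 s, normr_ge0 s0).
pose K := 1 + `|s| + `|s0|.
have K1 : 1 <= K by rewrite /K -addrA lerDl addr_ge0.
have K0 : 0 < K by exact: lt_le_trans K1.
have Kn : K != 0 by rewrite gt_eqF.
(* The sign chooses later or earlier times so that [(s - s0) * al] is positive: that is the half of
   the double wedge contained in the left half-ball and to the right of the slope-[s0] line. *)
pose al := (if s < s0 then -1 else 1) * (4 * K)^-1.
pose m := (s + s0) / 2.
pose D := `|s - s0|.
have D0 : 0 < D by rewrite normr_gt0 subr_eq0.
have DK : D <= K by apply: le_trans (ler_normB s s0) _; rewrite /K -addrA lerDr.
(* The mean slope [m] leaves a margin [D / (8 * K)] to either line, while the cell uses at most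
   [k * K = D / (32 * K)]. *)
pose k := D / (32 * K ^+ 2).
have k0 : 0 < k by rewrite divr_gt0 // mulr_gt0 // exprn_gt0.
have kK : k * K = D / (32 * K) by rewrite /k; field.
have alD : (s - s0) * al = D / (4 * K).
  rewrite mulrA /D; congr (_ * _); case: ltP => h.
    by rewrite mulrN1 ltr0_norm // subr_lt0.
  by rewrite mulr1 ger0_norm // subr_ge0.
have abs_al : `|al| = (4 * K)^-1.
  rewrite normrM (gtr0_norm (_ : 0 < (4 * K)^-1)) ?invr_gt0 ?mulr_gt0 //.
  by case: ifP => _; rewrite ?normrN normr1 mul1r.
have mK : 1 + `|m| <= K.
  rewrite /m normrM (gtr0_norm (_ : 0 < 2^-1)) ?invr_gt0 //.
  by move: (ler_normD s s0); rewrite /K; clear -n1 n2; lra.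
have W : k * K <= D / (8 * K).
  by rewrite kK ler_pM2l // lef_pV2 ?posrE ?mulr_gt0 // ler_pM2r // ler_nat.
have ks : k * (1 + `|s|) <= D / (8 * K).
  by apply: le_trans W; rewrite ler_pM2l // /K lerDl.
have ks0 : k * (1 + `|s0|) <= D / (8 * K).
  by apply: le_trans W; rewrite ler_pM2l // /K -addrA lerD2l lerDr.
have e2 : D / (8 * K) = (s - s0) * al / 2 by rewrite alD; field.
exists al, m, k; split=> //.
- rewrite (normrM al m) abs_al -[X in X + _ * `|m|]mulr1 -mulrDr.
  have i1 : (4 * K)^-1 * (1 + `|m|) <= 1 / 4.
    by rewrite (_ : 1 / 4 = (4 * K)^-1 * K) ?ler_pM2l ?invr_gt0 ?mulr_gt0 //; field.
  have i2 : k <= 1 / 32.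
    have -> : 1 / 32 = K / (32 * K) by field.
    apply: (@le_trans _ _ (k * K)); first by rewrite -[X in X <= _]mulr1 ler_pM2l.
    by rewrite kK ler_pM2r // invr_gt0 mulr_gt0.
  by clear -i1 i2; lra.
- by rewrite /m; clear -ks0 e2; lra.
- by rewrite /m; clear -ks e2; lra.
Qed.

(** On a square of radius [q] the quantity [x - s0 t] moves by less than its absolute value at [X],
    so its sign is constant. *)
Lemma locally_constant_off_line (T : Type) (s0 : R) X (a b : T) : X.2 != s0 * X.1 ->
  exists V, exists2 q : R, 0 < q &
    forall Y, square X q Y -> (if Y.2 < s0 * Y.1 then a else b) = V.
Proof.
move=> off; pose q := `|X.2 - s0 * X.1| / (2 * (1 + `|s0|)).
have A0 : 0 < `|X.2 - s0 * X.1| by rewrite normr_gt0 subr_eq0.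
have s00 := normr_ge0 s0; have s01 : 0 < 1 + `|s0| by rewrite ltr_pwDl.
have q0 : 0 < q by rewrite divr_gt0 // mulr_gt0.
have qE : q * (1 + `|s0|) = `|X.2 - s0 * X.1| / 2 by rewrite /q; field; rewrite gt_eqF.
have close Y : square X q Y ->
    `|Y.2 - X.2 - s0 * (Y.1 - X.1)| < `|X.2 - s0 * X.1|.
  move=> [h1 h2]; have := ler_normB (Y.2 - X.2) (s0 * (Y.1 - X.1)).
  rewrite normrM; have : `|s0| * `|Y.1 - X.1| <= `|s0| * q by rewrite ler_wpM2l // ltW.
  by move: h2 qE A0; clear; lra.
have [lt|ge] := ltP X.2 (s0 * X.1).
  exists a, q => // Y /close; rewrite [X in _ < X]ltr0_norm ?subr_lt0 //.
  rewrite ltr_norml => /andP[_ h]; have -> // : Y.2 < s0 * Y.1.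
  by move: h; clear; lra.
exists b, q => // Y /close; rewrite [X in _ < X]ger0_norm ?subr_ge0 //.
rewrite ltr_norml => /andP[h _]; rewrite (_ : (Y.2 < s0 * Y.1) = false) //.
by apply/negbTE; rewrite -leNgt; move: h; clear; lra.
Qed.

(** The only genuine jumps sit on the line of slope [s0], with that speed and the states [UL], [UR].
    Equal states are allowed, and then no jump exists; this is the case of the singular solution. *)
Lemma lax_ok_two_states gam (O : set (pt R)) (dr u E : pt R -> R) (s0 : R)
    (UL UR : R * R * R) (N : set (pt R)) :
  openS O -> measurable N -> leb2 N = 0%E ->
  (forall X, O X -> Omega X -> ~ N X ->
     (dr X, u X, E X) = if X.2 < s0 * X.1 then UL else UR) ->
  (UL <> UR -> lax_adm gam UL UR s0) ->
  lax_ok gam O dr u E.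
Proof.
move=> oO mN N0 hU lax X0 s Ul Ur OX0 OmX0 [ne jump].
pose U X := (dr X, u X, E X).
have hl : one_sided U X0 s true Ul.
  by move=> e /jump[d d0 h]; exists d => // r /h[].
have hr : one_sided U X0 s false Ur.
  by move=> e /jump[d d0 h]; exists d => // r /h[].
have [rO rO0 hrO] := oO _ OX0.
have [rM rM0 hrM] := openS_Omega OmX0.
have [k [k0 kle ks ks0]] := cell_constant s s0.
pose rr := Num.min rO rM.
have rr0 : 0 < rr by rewrite lt_min rO0.
have inO r Y : r < rr -> square X0 r Y -> O Y /\ Omega Y.
  rewrite lt_min => /andP[a1 a2] sY.
  by split; [apply/hrO/(square_sub (ltW a1))|apply/hrM/(square_sub (ltW a2))].
have down r Y : 0 < r -> cell X0 r 0 (- (1 / 2)) k Y ->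
   [/\ hball X0 s r true Y, Y.2 - X0.2 < s0 * (Y.1 - X0.1) & square X0 r Y].
  move=> r0 cY.
  have [] := cell_ball r0 k0 _ cY; first by rewrite normr0 normrN ger0_norm; lra.
  move=> b1 b2; split=> //; last by apply: (cone_lt r0 _ cY); rewrite mulr0; lra.
  by split=> //; apply: (cone_lt r0 _ cY); rewrite mulr0; lra.
have up r Y : 0 < r -> cell X0 r 0 (1 / 2) k Y ->
   [/\ hball X0 s r false Y, s0 * (Y.1 - X0.1) < Y.2 - X0.2 & square X0 r Y].
  move=> r0 cY.
  have [] := cell_ball r0 k0 _ cY; first by rewrite normr0 ger0_norm; lra.
  move=> b1 b2; split=> //; last by apply: (cone_gt r0 _ cY); rewrite mulr0; lra.
  by split=> //; apply: (cone_gt r0 _ cY); rewrite mulr0; lra.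
(* Off the line both half-balls carry the same state [V], which contradicts [Ul <> Ur]. *)
have [on|off] := eqVneq X0.2 (s0 * X0.1); last first.
  have [V [q q0 hV]] := locally_constant_off_line UL UR off.
  case: ne; pose r1 := Num.min rr q.
  have r10 : 0 < r1 by rewrite lt_min rr0.
  have inV r Y : 0 < r < r1 -> square X0 r Y -> ~ N Y -> U Y = V.
    move=> /andP[_]; rewrite lt_min => /andP[a1 a2] sY NY.
    have [OY OmY] := inO _ _ a1 sY; rewrite /U hU //; apply: hV.
    exact: square_sub (ltW a2) _ sY.
  have <- : V = Ul.
    apply: (one_sided_value (a := 0) (b := - (1 / 2)) mN N0 k0 r10 _ _ hl).
    - by move=> r Y /andP[r0 _] /(down _ _ r0)[].
    - by move=> r Y rr1; have /andP[r0 _] := rr1 => /(down _ _ r0)[_ _]; exact: inV.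
  apply: (one_sided_value (a := 0) (b := 1 / 2) mN N0 k0 r10 _ _ hr).
  - by move=> r Y /andP[r0 _] /(up _ _ r0)[].
  - by move=> r Y rr1; have /andP[r0 _] := rr1 => /(up _ _ r0)[_ _]; exact: inV.
have stL r Y : 0 < r < rr -> square X0 r Y -> ~ N Y ->
    Y.2 - X0.2 < s0 * (Y.1 - X0.1) -> U Y = UL.
  move=> /andP[_ rlt] sY NY h; have [OY OmY] := inO _ _ rlt sY.
  by rewrite /U hU //; have -> // : Y.2 < s0 * Y.1 by lra.
have stR r Y : 0 < r < rr -> square X0 r Y -> ~ N Y ->
    s0 * (Y.1 - X0.1) < Y.2 - X0.2 -> U Y = UR.
  move=> /andP[_ rlt] sY NY h; have [OY OmY] := inO _ _ rlt sY.
  rewrite /U hU // (_ : (Y.2 < s0 * Y.1) = false) //.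
  by apply/negbTE; rewrite -leNgt; lra.
have UlE : UL = Ul.
  apply: (one_sided_value (a := 0) (b := - (1 / 2)) mN N0 k0 rr0 _ _ hl).
  - by move=> r Y /andP[r0 _] /(down _ _ r0)[].
  - move=> r Y rr1; have /andP[r0 _] := rr1 => /(down _ _ r0)[_ h sY] NY.
    exact: (stL r).
have UrE : UR = Ur.
  apply: (one_sided_value (a := 0) (b := 1 / 2) mN N0 k0 rr0 _ _ hr).
  - by move=> r Y /andP[r0 _] /(up _ _ r0)[].
  - move=> r Y rr1; have /andP[r0 _] := rr1 => /(up _ _ r0)[_ h sY] NY.
    exact: (stR r).
have [->|sne] := eqVneq s s0.
  by rewrite -UlE -UrE; apply: lax; rewrite UlE UrE.
(* a wedge between the two lines lies in the left half-ball and carries [UR] *)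
case: ne; rewrite -UrE; apply/esym.
have [al [m [k' [k'0 small w0 w1]]]] := wedge_constant sne.
have wedge r Y : 0 < r -> cell X0 r al (al * m) k' Y ->
   [/\ hball X0 s r true Y, s0 * (Y.1 - X0.1) < Y.2 - X0.2 & square X0 r Y].
  move=> r0 cY; have [b1 b2] := cell_ball r0 k'0 small cY.
  split=> //; last exact: cone_gt r0 w0 cY.
  by split=> //; exact: cone_lt r0 w1 cY.
apply: (one_sided_value (a := al) (b := al * m) mN N0 k'0 rr0 _ _ hl).
- by move=> r Y /andP[r0 _] /(wedge _ _ r0)[].
- move=> r Y rr1; have /andP[r0 _] := rr1 => /(wedge _ _ r0)[_ h sY] NY.
  exact: (stR r).
Qed.

End jump.

(** * Two-state solutions *)

Section two_state_integrals.
Context {R : realType}.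
Implicit Types (phi : pt R -> R) (s qL qR : R) (X : pt R).

(** Scalar counterpart of [pc3]. Products of such functions have the same shape, so each conserved
    quantity and flux is again a pair of constants. *)
Definition pc1 s qL qR X : R :=
  if (0 <= X.1) && (X.2 <= 0) then (if X.2 < s * X.1 then qL else qR) else 0.

Lemma pc3E (F : R * R * R -> R) s UL UR X : F (0, 0, 0) = 0 ->
  F (pc3 s UL UR X) = pc1 s (F UL) (F UR) X.
Proof. by move=> F0; rewrite /pc3 /pc1; case: ifP => // _; case: ifP. Qed.

Lemma measurable_pc1 s qL qR : measurable_fun setT (pc1 s qL qR).
Proof.
apply: measurable_fun_ifT => //.
  by apply: measurable_and; apply: measurable_fun_ler.
apply: measurable_fun_ifT => //.
by apply: measurable_fun_ltr => //; exact: measurable_funM.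
Qed.

Lemma pc1_bounded s qL qR X : `|pc1 s qL qR X| <= `|qL| + `|qR|.
Proof.
have := normr_ge0 qL; have := normr_ge0 qR.
by rewrite /pc1; case: ifP => _; [case: ifP => _|rewrite normr0]; lra.
Qed.

Lemma density_ok_pc1 s qL qR : 0 <= qL -> 0 <= qR -> density_ok (pc1 s qL qR).
Proof.
move=> L0 R0; split; first exact: measurable_pc1.
split; last by exists (`|qL| + `|qR|) => X; exact: le_trans (ler_norm _) (pc1_bounded _ _ _ _).
by move=> X; rewrite /pc1; case: ifP => // _; case: ifP.
Qed.

Lemma Rintegral_ae_eq (f h : pt R -> R) (N : set (pt R)) :
  measurable_fun setT f -> measurable_fun setT h -> measurable N -> leb2 N = 0%E ->
  (forall X, ~ N X -> f X = h X) -> Rintegral leb2 setT f = Rintegral leb2 setT h.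
Proof.
move=> mf mh mN N0 fh; rewrite /Rintegral; congr fine; apply: ae_eq_integral => //.
- exact/measurable_EFinP.
- exact/measurable_EFinP.
exists N; split=> // X /= h'; apply: contrapT => NX; apply: h' => _.
by rewrite fh.
Qed.

Lemma leb2_setU0 (A B : set (pt R)) : measurable A -> measurable B ->
  leb2 A = 0%E -> leb2 B = 0%E -> leb2 (A `|` B) = 0%E.
Proof.
move=> mA mB A0 B0; have h := measureU2 leb2 mA mB.
have sum0 (a b : \bar R) : (a = 0 -> b = 0 -> a + b <= 0)%E.
  by move=> -> ->; rewrite adde0.
apply/eqP; rewrite eq_le measure_ge0 andbT.
exact: le_trans h (sum0 _ _ A0 B0).
Qed.

(** States are prescribed on the closed quadrant while the wedges are cut from the open one; the two
    differ on this null set only. *)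
Definition axes : set (pt R) :=
  [set 0] `*` [set: measurableTypeR R] `|` [set: measurableTypeR R] `*` [set 0].

Lemma measurable_axes : measurable axes.
Proof. by apply: measurableU; apply: measurableX. Qed.

Lemma leb2_axes : leb2 axes = 0%E.
Proof.
have l0 : leb1 [set (0 : R)] = 0%E by exact: lebesgue_measure_set1.
apply: leb2_setU0; [exact: measurableX|exact: measurableX| |].
  by apply: etrans (leb2_rect _ _) _; rewrite // l0 mul0e.
by apply: etrans (leb2_rect _ _) _; rewrite // l0 mule0.
Qed.

Definition inOmega X := (0 < X.1) && (X.2 < 0).
Definition wedgeL s X := (0 < X.1) && (X.2 < s * X.1).
Definition wedgeR s X := [&& 0 < X.1, X.2 < 0 & s * X.1 <= X.2].

Definition intL s phi := Rintegral leb2 setT (fun X => (wedgeL s X)%:R * phi X).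
Definition intR s phi := Rintegral leb2 setT (fun X => (wedgeR s X)%:R * phi X).

Lemma measurable_inOmega : measurable_fun setT inOmega.
Proof. by apply: measurable_and; apply: measurable_fun_ltr. Qed.

Lemma Rintegral_lin (a b : R) (f h : pt R -> R) : bcs f -> bcs h ->
  Rintegral leb2 setT (fun X => a * f X + b * h X) =
  a * Rintegral leb2 setT f + b * Rintegral leb2 setT h.
Proof.
move=> bf bh; have i1 := bcs_integrable radon_leb2 bf; have i2 := bcs_integrable radon_leb2 bh.
rewrite RintegralD //; last 2 first.
- exact: (bcs_integrable radon_leb2 (bcsZ a bf)).
- exact: (bcs_integrable radon_leb2 (bcsZ b bh)).
by rewrite !RintegralZl.
Qed.

(** The sign of [s] keeps the points [x < s * t] to the left of the piston, which is why [wedgeL]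
    carries no condition [x < 0]. *)
Lemma Rintegral_pc1 s qL qR phi : s <= 0 -> bcs phi ->
  Rintegral leb2 setT (fun X => pc1 s qL qR X * phi X) =
  qL * intL s phi + qR * intR s phi.
Proof.
move=> s0 bp; have [mp _] := bp.
have bL := bcs_ind (measurable_Omega_lt s) bp.
have bR := bcs_ind (measurable_Omega_ge s) bp.
rewrite -Rintegral_lin //.
apply: (Rintegral_ae_eq (N := axes)).
- by apply: measurable_funM => //; exact: measurable_pc1.
- by apply: measurable_funD; apply: measurable_funM => //; [case: bL|case: bR].
- exact: measurable_axes.
- exact: leb2_axes.
move=> X NX; rewrite /pc1 /wedgeL /wedgeR !mulrA -mulrDl; congr (_ * _).
have X1 : X.1 != 0 by apply/eqP => h; apply: NX; left.
have X2 : X.2 != 0 by apply/eqP => h; apply: NX; right.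
rewrite le_eqVlt eq_sym (negbTE X1) /= (le_eqVlt X.2) (negbTE X2) /=.
case: (ltP 0 X.1) => h1 /=; last by rewrite !mulr0 addr0.
case: (ltP X.2 0) => h2 /=.
  by case: (ltP X.2 (s * X.1)) => h3; rewrite /= ?mulr0 ?mulr1 ?addr0 ?add0r.
rewrite mulr0 addr0; case: (ltP X.2 (s * X.1)) => h3; rewrite /= ?mulr0 //.
by have := mulr_le0_ge0 s0 (ltW h1); lra.
Qed.

Lemma intLR s phi : s <= 0 -> bcs phi -> intL s phi + intR s phi =
  Rintegral leb2 setT (fun X => (inOmega X)%:R * phi X).
Proof.
move=> s0 bp; have := Rintegral_pc1 1 1 s0 bp; rewrite !mul1r => <-.
have [mp _] := bp.
apply: (Rintegral_ae_eq (N := axes)).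
- by apply: measurable_funM => //; exact: measurable_pc1.
- by apply: measurable_funM => //; apply: measurable_ind; exact: measurable_inOmega.
- exact: measurable_axes.
- exact: leb2_axes.
move=> X NX; rewrite /pc1 /inOmega; congr (_ * _).
have X1 : X.1 != 0 by apply/eqP => h; apply: NX; left.
have X2 : X.2 != 0 by apply/eqP => h; apply: NX; right.
rewrite le_eqVlt eq_sym (negbTE X1) /= (le_eqVlt X.2) (negbTE X2) /= if_same.
by case: ifP.
Qed.

Definition piston_tr phi := Rintegral leb1 setT (fun t : R => (0 < t)%R%:R * phi (t, 0)).
Definition init_tr phi := Rintegral leb1 setT (fun x : R => (x < 0)%R%:R * phi (0, x)).
Definition line_tr s phi := Rintegral leb1 setT (fun t : R => (0 < t)%R%:R * phi (t, s * t)).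

Lemma init_term (c : R) phi : bcs phi ->
  Rintegral leb1 `]-oo, 0[%classic (fun x => c * phi (0, x)) = c * init_tr phi.
Proof.
move=> bp; rewrite /init_tr -RintegralZl //; last first.
  apply: bcs1_integrable; apply: (bcs_pairt 0 (bcs_ind (P := fun X => X.2 < 0) _ bp)).
  exact: measurable_fun_ltr.
rewrite -(Rintegral_ind (P := fun x => x < 0)).
  by apply: eq_Rintegral => x _; rewrite mulrCA.
by move=> x; left; rewrite mem_setE in_itv.
Qed.

Lemma piston_term (c : R) phi : bcs phi ->
  Rintegral leb1 `[0, +oo[%classic (fun t => c * phi (t, 0)) = c * piston_tr phi.
Proof.
move=> bp; have bK := bcs_pairx 0 bp.
have ik : leb1.-integrable `]0, +oo[%classic (EFin \o (fun t => c * phi (t, 0))).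
  apply: (@integrableS _ _ _ _ setT) => //; apply: bcs1_integrable.
  have := bcs1M bK (measurable_cst c); under [in X in _ -> X]eq_fun do rewrite mulrC.
  by apply=> K; exists `|c|.
rewrite -[LHS]Rintegral_itv_obnd_cbnd //.
rewrite /piston_tr -RintegralZl //; last first.
  apply: bcs1_integrable; apply: (bcs_pairx 0 (bcs_ind (P := fun X => 0 < X.1) _ bp)).
  exact: measurable_fun_ltr.
transitivity (Rintegral leb1 setT (fun t : R => (0 < t)%R%:R * (c * phi (t, 0)))).
  by apply/esym/Rintegral_ind => x; left; rewrite mem_setE in_itv /= andbT.
by apply: eq_Rintegral => x _; rewrite mulrCA.
Qed.

Lemma Omega_dx phi phit phix : C10 phi phit phix ->
  Rintegral leb2 setT (fun X => (inOmega X)%:R * phix X) = piston_tr phi.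
Proof.
move=> C; have := wedge_dx C 0.
under eq_fun do rewrite oppr0 mul0r; move=> ->.
by apply: eq_Rintegral => t _; rewrite oppr0 mul0r.
Qed.

(* The coefficient of [line_tr] is the Rankine-Hugoniot defect across [x = s t]. *)
Lemma two_state_weak_form (s QL QR FL FR : R) phi phit phix : s < 0 ->
  C10 phi phit phix ->
  Rintegral leb2 setT (fun X => pc1 s QL QR X * phit X) +
  Rintegral leb2 setT (fun X => pc1 s FL FR X * phix X) =
  - QL * init_tr phi + FR * piston_tr phi
  + (FL - FR - s * (QL - QR)) * line_tr s phi.
Proof.
move=> s0 C; have [bp bt bx] := C10_bcs C.
have eL : intL s phix = line_tr s phi.
  by have := wedge_dx C (- s); rewrite opprK.
have eR : intR s phit = s * line_tr s phi.
  have := wedge_dt C (_ : 0 < - s); rewrite oppr_gt0 => /(_ s0).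
  by rewrite opprK.
have e1 := intLR (ltW s0) bt; have e2 := intLR (ltW s0) bx.
have e3 := Omega_dt C; have e4 := Omega_dx C.
rewrite /inOmega in e1 e2 e4; rewrite -/(init_tr phi) in e3.
rewrite !Rintegral_pc1 ?(ltW s0) //.
(* Over all of [Omega] the time derivative sees only the initial line and the space derivative only
   the piston, so the two remaining wedge integrals are found by complement. *)
have -> : intL s phit = - init_tr phi - intR s phit by rewrite -e3 -e1; lra.
have -> : intR s phix = piston_tr phi - intL s phix by rewrite -e4 -e2; lra.
rewrite eL eR; lra.
Qed.

Lemma Rintegral_Omega_pc1 s QL QR FL FR (q f : pt R -> R) (phi psi : pt R -> R) :
  bcs phi -> bcs psi ->
  (forall X, Omega X -> q X = pc1 s QL QR X) ->
  (forall X, Omega X -> f X = pc1 s FL FR X) ->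
  Rintegral leb2 Omega (fun X => q X * phi X + f X * psi X) =
  Rintegral leb2 setT (fun X => pc1 s QL QR X * phi X) +
  Rintegral leb2 setT (fun X => pc1 s FL FR X * psi X).
Proof.
move=> bp bs qE fE.
have b1 a b (h : pt R -> R) : bcs h -> bcs (fun X => pc1 s a b X * h X).
  move=> bh; have := bcsM bh (measurable_pc1 s a b).
  under [in X in _ -> X]eq_fun do rewrite mulrC.
  by apply; exists (`|a| + `|b|); exact: pc1_bounded.
have c1 := b1 QL QR _ bp; have c2 := b1 FL FR _ bs.
rewrite -RintegralD //; [|exact: bcs_integrable radon_leb2 c1|exact: bcs_integrable radon_leb2 c2].
have mO := openS_measurable (@openS_Omega R).
have [m1 _] := c1; have [m2 _] := c2.
transitivity (Rintegral leb2 Omega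
    (fun X => pc1 s QL QR X * phi X + pc1 s FL FR X * psi X)).
  by apply: eq_Rintegral => X /set_mem OX; rewrite qE ?fE.
rewrite [LHS]Rintegral_mkcond.
apply: (Rintegral_ae_eq (N := axes)).
- apply/(measurable_restrictT _ mO); apply: measurable_funS (measurable_funD m1 m2) => //.
- exact: measurable_funD.
- exact: measurable_axes.
- exact: leb2_axes.
move=> X NX; rewrite /patch; case: ifPn => // /negP XO.
suff z a b : pc1 s a b X = 0 by rewrite !z !mul0r addr0.
 rewrite /pc1; case: ifP => // /andP[h1 h2]; case: XO; apply/mem_set.
split; rewrite lt_neqAle ?h1 ?h2 andbT; apply/eqP => h;
  apply: NX; [left|right] => //.
Qed.

End two_state_integrals.

Section measure_solution_tools.
Context {R : realType}.
Implicit Types (f dr dp : pt R -> R) (g : R -> R) (O N : set (pt R)).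

(** Passing to a smaller open [O] makes it possible to leave the piston out when the measure charges
    it. *)
Lemma sL2_on_ae O O' f g dr : density_ok f -> weight_ok g -> openS O ->
  O `<=` O' -> (forall t, 0 <= t -> g t = 0 \/ ~ O (t, 0)) ->
  sL2_on O' (DLs f g) dr ->
  exists N, [/\ measurable N, leb2 N = 0%E & forall X, O X -> ~ N X -> dr X = f X].
Proof.
move=> fok gok oO OO' gO h; apply: ae_eq_open => // A mA bA AO.
have [i e] := h A mA bA (subset_trans AO OO'); split=> //.
rewrite -e; apply: sval_DLs_off => // t t0.
by case: (gO t t0) => [|NO]; [left|right => /AO].
Qed.

(** Every point of the closed quadrant, also on its boundary, is close to a square inside [Omega]:
    shift forward in time and towards the gas by [r / 2]. A positive lower bound on the density
    gives that square mass. *)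
Lemma snull_no_mass f g (c : R) (X : pt R) (r : R) : density_ok f -> weight_ok g ->
  0 < c -> (forall Y, Omega Y -> c <= f Y) -> Omegab X -> 0 < r ->
  ~ snull (DLs f g) (square X r).
Proof.
move=> fok gok c0 cf [X1 X2] r0 hnull.
pose Y : pt R := (X.1 + r / 2, X.2 - r / 2).
pose S := square Y (r / 4).
have mS : measurable S by exact: measurable_square.
have r4 : 0 < r / 4 by lra.
have SO Z : S Z -> square X r Z /\ Omega Z.
  move=> [] /=; rewrite !ltr_distl => /andP[a1 a2] /andP[b1 b2].
  by split; split; rewrite ?ltr_distl; try (apply/andP; split); lra.
have bS : bnd S by exact: bnd_square.
have := hnull S mS bS (fun Z SZ => (SO Z SZ).1).
rewrite sval_DLs_fine => h0.
have hE : DL f g S = 0%E.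
  by rewrite -(fineK (x := DL f g S)) ?h0 // ge0_fin_numE // DL_lty.
have [mf [f0 _]] := fok.
have : (c%:E * leb2 S <= DL f g S)%E.
  rewrite DLE; apply: le_trans (leeDl _ _); last exact: measure_ge0.
  apply: le_trans (integral_lower_bound (D := S) mS (fun Z SZ => SZ) f0 (ltW c0) _) _.
    by move=> Z /SO[_ /cf].
  by rewrite le_eqVlt; apply/orP; left; apply/eqP/esym; exact: dmeasE.
rewrite hE (leb2_square _ r4) -EFinM lee_fin leNgt => /negP; apply.
by rewrite mulr_gt0 // exprn_gt0 // mulr_gt0.
Qed.

Lemma integrable_cst_itv (c T : R) : leb1.-integrable `[0, T]%classic (EFin \o (fun=> c)).
Proof. by apply: continuous_integrable_itv => x; exact: cvg_cst. Qed.

End measure_solution_tools.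

(** * Two states joined by the Rankine-Hugoniot relations *)

Section two_state.
Context {R : realType}.
Variables (gam E0 r1 e1 s : R).

Let UL : R * R * R := (1, 1, E0).
Let UR : R * R * R := (r1, 0, e1).
Let pL := press gam 1 1 E0.
Let pR := press gam r1 0 e1.
Let U := pc3 s UL UR.
Let Z (a b : R) := DLs (pc1 s a b) (fun _ : R => 0).

Lemma pc1M (a b c d : R) X : pc1 s a b X * pc1 s c d X = pc1 s (a * c) (b * d) X.
Proof. by rewrite /pc1; case: ifP => _; [case: ifP|rewrite mul0r]. Qed.

Lemma induced_ms_pc3 (wp : R -> R) : induced_ms gam U wp =
  MSD (Z 1 r1) (Z 1 0) (Z 1 0) (Z E0 (r1 * e1)) (Z E0 0) (Z pL 0) (Z pL pR) wp
    (pc1 s 1 0) (pc1 s E0 e1).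
Proof.
have h (F : R * R * R -> R) a b : F (0, 0, 0) = 0 -> F UL = a -> F UR = b ->
    (fun X => F (U X)) = pc1 s a b.
  by move=> F0 <- <-; apply/funext => X; exact: pc3E.
rewrite /induced_ms; congr MSD; rewrite ?/Z; try congr DLs.
- exact: (h (fun V => V.1.1)).
- by apply: (h (fun V => V.1.1 * V.1.2)); rewrite /= ?mulr0 ?mul1r.
- by apply: (h (fun V => V.1.1 * V.1.2 ^+ 2)); rewrite /= ?expr0n ?expr1n ?mulr0 ?mul1r.
- by apply: (h (fun V => V.1.1 * V.2)); rewrite /= ?mulr0 ?mul1r.
- by apply: (h (fun V => V.1.1 * V.1.2 * V.2)); rewrite /= ?mulr0 ?mul0r ?mul1r.
- by apply: (h (fun V => V.1.2 * press gam V.1.1 V.1.2 V.2)); rewrite /= ?mul0r ?mul1r.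
- by apply: (h (fun V => press gam V.1.1 V.1.2 V.2)); rewrite /= // /press mulr0 mul0r.
- exact: (h (fun V => V.1.2)).
- exact: (h (fun V => V.2)).
Qed.

Hypotheses (s0 : s < 0) (r10 : 0 < r1) (E00 : 0 <= E0) (e10 : 0 <= e1)
  (pL0 : 0 <= pL) (pR0 : 0 <= pR).
Hypotheses (RHmass : 1 = s * (1 - r1)) (RHmom : 1 + pL - pR = s)
  (RHen : E0 + pL = s * (E0 - r1 * e1)).
Hypothesis lax : lax_adm gam UL UR s.

(** Each Rankine-Hugoniot hypothesis cancels one coefficient of [line_tr]. Since the gas rests
    behind the shock, only the momentum flux leaves a trace on the piston, namely the pressure. *)
Let conservation phi phit phix : C10 phi phit phix ->
  [/\ Rintegral leb2 setT (fun X => pc1 s 1 r1 X * phit X) +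
      Rintegral leb2 setT (fun X => pc1 s 1 0 X * phix X) = - init_tr phi,
      Rintegral leb2 setT (fun X => pc1 s 1 0 X * phit X) +
      Rintegral leb2 setT (fun X => pc1 s (1 + pL) pR X * phix X) =
      - init_tr phi + pR * piston_tr phi &
      Rintegral leb2 setT (fun X => pc1 s E0 (r1 * e1) X * phit X) +
      Rintegral leb2 setT (fun X => pc1 s (E0 + pL) 0 X * phix X) =
      - (E0 * init_tr phi)].
Proof.
move=> C; rewrite !(two_state_weak_form _ _ _ _ s0 C); split.
- by rewrite -RHmass !subr0 subrr; lra.
- by rewrite RHmom subr0 mulr1 subrr; lra.
- by rewrite -RHen subr0 subrr; lra.
Qed.

Lemma two_state_weak_sol :
  weak_sol gam 1 E0 (fun X => (U X).1.1) (fun X => (U X).1.2) (fun X => (U X).2).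
Proof.
have e (F : R * R * R -> R) a b : F (0, 0, 0) = 0 -> F UL = a -> F UR = b ->
    forall X, F (U X) = pc1 s a b X.
  by move=> F0 <- <- X; exact: pc3E.
have eR := e (fun V => V.1.1) 1 r1 erefl erefl erefl.
have eU := e (fun V => V.1.2) 1 0 erefl erefl erefl.
have eE := e (fun V => V.2) E0 e1 erefl erefl erefl.
rewrite /weak_sol; split; last split.
- have mO := openS_measurable (@openS_Omega R).
  have mp a b : measurable_fun Omega (pc1 s a b).
    by apply: measurable_funS (measurable_pc1 s a b).
  split; first by under eq_fun do rewrite eR; exact: mp.
  split; first by under eq_fun do rewrite eU; exact: mp.
  split; first by under eq_fun do rewrite eE; exact: mp.
  exists (`|1 : R| + `|r1| + (`|1 : R| + `|0 : R|) + (`|E0| + `|e1|)) => X _; rewrite eR eU eE.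
  have b1 := pc1_bounded s 1 r1 X; have b2 := pc1_bounded s 1 0 X.
  have b3 := pc1_bounded s E0 e1 X.
  by repeat split; have := normr_ge0 (pc1 s 1 r1 X); have := normr_ge0 (pc1 s 1 0 X);
    have := normr_ge0 (pc1 s E0 e1 X); lra.
- move=> phi phit phix C; have [bp bt bx] := C10_bcs C.
  have [c1 c2 c3] := conservation C.
  rewrite (@Rintegral_Omega_pc1 _ s 1 r1 1 0 (fun X => (U X).1.1)
      (fun X => (U X).1.1 * (U X).1.2)) //; last first.
    by move=> X _; rewrite eR eU pc1M mulr1 mulr0.
  rewrite (@Rintegral_Omega_pc1 _ s 1 0 (1 + pL) pR (fun X => (U X).1.1 * (U X).1.2)
      (fun X => (U X).1.1 * (U X).1.2 ^+ 2 + press gam (U X).1.1 (U X).1.2 (U X).2)) //;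
      last 2 first.
    by move=> X _; rewrite eR eU pc1M mulr1 mulr0.
    move=> X _; apply: (e (fun V => V.1.1 * V.1.2 ^+ 2 + press gam V.1.1 V.1.2 V.2)).
    - by rewrite /= /press; lra.
    - by rewrite /= expr1n mulr1.
    - by rewrite /= expr0n mulr0 add0r.
  rewrite (@Rintegral_Omega_pc1 _ s E0 (r1 * e1) (E0 + pL) 0 (fun X => (U X).1.1 * (U X).2)
      (fun X => (U X).1.1 * (U X).1.2 * (U X).2 +
        (U X).1.2 * press gam (U X).1.1 (U X).1.2 (U X).2)) //; last 2 first.
    by move=> X _; rewrite eR eE pc1M mul1r.
    move=> X _; apply: (e (fun V => V.1.1 * V.1.2 * V.2 + V.1.2 * press gam V.1.1 V.1.2 V.2)).
    - by rewrite /=; lra.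
    - by rewrite /= !mul1r.
    - by rewrite /= !mulr0 !mul0r addr0.
  rewrite c1 c2 c3 !mulr1 !init_term //.
  rewrite (_ : Rintegral leb1 `[0, +oo[%classic _ = pR * piston_tr phi); last first.
    rewrite -piston_term //; apply: eq_Rintegral => t.
    rewrite mem_setE in_itv /= andbT => t0; congr (_ * _).
    rewrite (e (fun V => press gam V.1.1 V.1.2 V.2) pL pR) //; last first.
      by rewrite /= /press; lra.
    (* On the piston the test [0 < s * t] fails for every [t >= 0], so the trace there is the right
       state. *)
    by rewrite /pc1 /= t0 lexx /= ltNge (mulr_le0_ge0 (ltW s0) t0).
  by split; [|split]; lra.
- apply: (@lax_ok_two_states _ gam Omega _ _ _ s UL UR set0) => //.
  + exact: openS_Omega.
  + move=> X _ [X1 X2] _; rewrite /U /pc3 (ltW X1) (ltW X2) /=.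
    by case: ifP.
Qed.

Lemma two_state_measure_sol : measure_sol gam 1 E0 (induced_ms gam U (fun=> pR)).
Proof.
have w0 := @weight_ok0 R.
have dok a b : 0 <= a -> 0 <= b -> density_ok (pc1 s a b) by exact: density_ok_pc1.
have d1 : density_ok (pc1 s 1 r1) by apply: dok; rewrite // ltW.
have d2 : density_ok (pc1 s 1 0) by exact: dok.
have d3 : density_ok (pc1 s E0 (r1 * e1)) by apply: dok => //; rewrite mulr_ge0 // ltW.
have d4 : density_ok (pc1 s E0 0) by exact: dok.
have d5 : density_ok (pc1 s pL 0) by exact: dok.
have d6 : density_ok (pc1 s pL pR) by exact: dok.
have supp a b (X : pt R) : ~ Omegab X -> pc1 s a b X = 0.
  by move=> h; rewrite /pc1; case: ifP => // /andP[h1 h2]; case: h.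
have ok f : density_ok f -> (forall X, ~ Omegab X -> f X = 0) ->
    sradon (DLs f (fun _ : R => 0)) /\ supp_Ob (DLs f (fun _ : R => 0)).
  by move=> df sf; split; [exact: sradon_DLs|exact: supp_DLs].
have dens a b c d : density_ok (pc1 s a b) -> 
    density_ok (pc1 s (a * c) (b * d)) ->
    sdens (Z (a * c) (b * d)) (pc1 s c d) (Z a b).
  move=> h1 h2; apply: sdens_DLs => //; first exact: measurable_pc1.
    by exists (`|c| + `|d|); exact: pc1_bounded.
  by move=> X; rewrite pc1M.
  by move=> t _; rewrite mul0r.
rewrite induced_ms_pc3 /measure_sol; split; last split; last split; last split.
- split; first exact: (ok _ d1 (supp _ _)).
  split; first exact: (ok _ d2 (supp _ _)).
  split; first exact: (ok _ d2 (supp _ _)).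
  split; first exact: (ok _ d3 (supp _ _)).
  split; first exact: (ok _ d4 (supp _ _)).
  by split; [exact: (ok _ d5 (supp _ _))|exact: (ok _ d6 (supp _ _))].
- by move=> T _; exact: integrable_cst_itv.
- move=> phi phit phix C; have [bp bt bx] := C10_bcs C.
  have [c1 c2 c3] := conservation C.
  have i := fun a b h (bh : bcs h) => Rintegral_pc1 a b (ltW s0) bh.
  rewrite /wdelta !spair_DLs0 // !mulr1 !init_term // piston_term //.
  move: c1 c2 c3; rewrite !i //.
  by repeat split; lra.
- split; first exact: snonneg_DLs.
  split; first by have := dens 1 r1 1 0; rewrite mulr1 mulr0; apply.
  split; first by have := dens 1 0 1 0; rewrite mulr1 mulr0; apply.
  split; first by have := dens 1 r1 E0 e1; rewrite mul1r; apply.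
  split; first by have := dens E0 (r1 * e1) 1 0; rewrite mulr1 mulr0; apply.
  split; first by have := dens pL pR 1 0; rewrite mulr1 mulr0; apply.
  split.
    move=> N mN nul B mB bB BN.
    have := nul B mB bB BN.
    rewrite !(sval_DLs_off _ w0) //; try by move=> t _; left.
    (* [c] makes [p <= c * rho] in both states, so the pressure integral over a set without mass is
       squeezed to 0. *)
    move=> h0; pose c := pL + pR / r1.
    have c0 : 0 <= c by rewrite addr_ge0 // divr_ge0 // ltW.
    have le X : pc1 s pL pR X <= c * pc1 s 1 r1 X.
      rewrite /pc1; case: ifP => _; last by rewrite mulr0.
      have q0 : 0 <= pR / r1 by rewrite divr_ge0 // ltW.
      case: ifP => _; first by rewrite mulr1 /c; lra.
      by rewrite /c mulrDl divfK ?gt_eqF // lerDr mulr_ge0 // ltW.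
    apply/eqP; rewrite eq_le; apply/andP; split; last first.
      by have [_ [h _]] := d6; apply: Rintegral_ge0 => X _; exact: h.
    have ->: 0 = c * 0 by rewrite mulr0.
    rewrite -h0 -RintegralZl //; last exact: density_ok_integrable.
    apply: le_Rintegral => //; first exact: density_ok_integrable.
      have := integrableZl mB c (density_ok_integrable d1 mB bB).
      by congr (leb2.-integrable _ _); apply/funext => X /=; rewrite EFinM.
    by move=> X _; exact: le.
  move=> X [r r0 nul].
  case: (pselect (Omegab X)) => XO; last by rewrite !supp.
  exfalso; apply: (snull_no_mass (c := Num.min 1 r1) d1 w0 _ _ XO r0 nul).
    by rewrite lt_min ltr01.
  move=> Y [Y1 Y2]; rewrite /pc1 (ltW Y1) (ltW Y2) /= ge_min.
  by case: ifP => _; rewrite lexx ?orbT.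
- move=> O dr dp oO hr hp.
  have g0 (t : R) : 0 <= t -> (0 : R) = 0 \/ ~ O (t, 0) by left.
  have [N1 [mN1 N10 hN1]] := sL2_on_ae d1 w0 oO (@subset_refl _ O) g0 hr.
  have [N2 [mN2 N20 hN2]] := sL2_on_ae d6 w0 oO (@subset_refl _ O) g0 hp.
  split.
    exists (N1 `|` N2); split; first exact: measurableU.
      exact: leb2_setU0.
    move=> X /= h; apply: contrapT => /not_orP[h1 h2]; apply: h => OX.
    rewrite hN1 // hN2 // /pc1; case: ifP => _; last by rewrite /press; lra.
    by case: ifP.
  apply: (lax_ok_two_states oO mN1 N10 _ (fun=> lax)) => X OX [X1 X2] NX.
  by rewrite hN1 // /pc1 (ltW X1) (ltW X2) /=; case: ifP.
Qed.

End two_state.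

(** * The singular solution *)

Section singular.
Context {R : realType}.

Let S (c q : R) := DLs (fun X => c * indO X) (fun t : R => q * t).

Definition time_tr (phi : pt R -> R) :=
  Rintegral leb1 setT (fun t : R => (0 < t)%R%:R * (t * phi (t, 0))).

Lemma indOE (X : pt R) : indO X = (inOmega X)%:R.
Proof. by rewrite /indO /inOmega; case: ifP. Qed.

Lemma measurable_indO : measurable_fun setT (@indO R).
Proof.
rewrite (_ : indO = fun X => (inOmega X)%:R); last by apply/funext => X; exact: indOE.
by apply: measurable_ind; exact: measurable_inOmega.
Qed.

Lemma density_ok_indO (c : R) : 0 <= c -> density_ok (fun X => c * indO X).
Proof.
move=> c0; split; last split.
- by apply: measurable_funM; [exact: measurable_cst|exact: measurable_indO].
- by move=> X; rewrite indOE mulr_ge0.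
- by exists c => X; rewrite indOE; case: (inOmega X); rewrite ?mulr1 ?mulr0.
Qed.

Lemma bcs1_time (phi : pt R -> R) : bcs phi -> bcs1 (fun t : R => t * phi (t, 0)).
Proof.
move=> bp; have := bcs1M (bcs_pairx 0 bp) (@measurable_id _ (measurableTypeR R) setT).
under [in X in _ -> X]eq_fun do rewrite mulrC.
by apply=> K; exists K.
Qed.

Lemma spair_singular (c q : R) (phi : pt R -> R) : 0 <= c -> 0 <= q -> bcs phi ->
  spair (S c q) phi =
  c * Rintegral leb2 setT (fun X => (inOmega X)%:R * phi X) + q * time_tr phi.
Proof.
move=> c0 q0 bp; rewrite spair_DLs //; [|exact: density_ok_indO|exact: weight_ok_lin].
congr (_ + _).
  rewrite -RintegralZl //; last first.
    by apply: (bcs_integrable radon_leb2); apply: bcs_ind => //; exact: measurable_inOmega.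
  by apply: eq_Rintegral => X _; rewrite indOE mulrA.
rewrite -RintegralZl //; last first.
  apply: bcs1_integrable; have := bcs1M (bcs1_time bp) (measurable_ind (P := fun t : measurableTypeR R => 0 < t) _).
  under [in X in _ -> X]eq_fun do rewrite mulrC.
  apply; first exact: measurable_fun_ltr.
  by exists 1 => t _; case: (0 < t); rewrite ?normr1 ?normr0.
apply: eq_Rintegral => t _; rewrite /half_weight; case: (ltgtP 0 t) => [t0|t0|<-].
- by rewrite mul1r mulrA.
- by rewrite !mul0r mulr0.
- by rewrite mul0r !mulr0 mul0r.
Qed.

(** The fundamental theorem for [t * phi (t, 0)], whose factor [t] removes the boundary term at time
    0. Thus a mass growing at unit rate on the piston absorbs the flux arriving there. *)
Lemma time_tr_dt (phi phit phix : pt R -> R) : C10 phi phit phix ->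
  time_tr phit = - piston_tr phi.
Proof.
move=> C; have [bp bt bx] := C10_bcs C; move: C => [_ [cp [ct [_ [dt _]]]]].
have [_ [_ [M M0 pM]]] := bp.
have mg : measurable_fun setT (fun t : measurableTypeR R => 0 < t) by exact: measurable_fun_ltr.
have ig (f : measurableTypeR R -> R) : bcs1 f ->
    leb1.-integrable setT (EFin \o (fun t => (0 < t)%R%:R * f t)).
  move=> bf; apply: bcs1_integrable; have := bcs1M bf (measurable_ind mg).
  under [in X in _ -> X]eq_fun do rewrite mulrC.
  by apply=> K; exists 1 => t _; case: (0 < t); rewrite ?normr1 ?normr0.
apply/eqP; rewrite -addr_eq0; apply/eqP.
rewrite /time_tr /piston_tr -RintegralD //; last 2 first.
- exact: (ig _ (bcs1_time bt)).
- exact: (ig _ (bcs_pairx 0 bp)).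
have d (t : R) : is_derive t (1 : R) (fun t : R => t * phi (t, 0)) (t * phit (t, 0) + phi (t, 0)).
  have d1 := dt (t, 0); rewrite /= in d1.
  have := is_deriveM (is_derive_id t (1 : R)) d1.
  by move=> h; apply: is_derive_eq h _; rewrite /GRing.scale /= mulr1.
have cc : continuous (fun t : R => t * phit (t, 0) + phi (t, 0)).
  move=> t; apply: cvgD; last exact: cont2_t.
  by apply: cvgM; [exact: cvg_id|exact: cont2_t].
have hM (t : R) : ~ `|t| <= M -> t * phi (t, 0) = 0.
  by move=> h; rewrite pM ?mulr0 // => -[].
have := Rintegral_derive_gt d cc hM 0; rewrite mul0r oppr0 => h.
by apply: etrans h; apply: eq_Rintegral => t _; rewrite mulrDr.
Qed.

Lemma sing_msE (E0 : R) : sing_ms E0 = MSD (S 1 1) (S 1 0) (S 1 0) (S E0 E0) (S E0 0)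
  (S 0 0) (S 0 0) (fun=> 1) indO (fun X => E0 * indOb X).
Proof.
have e1 : (fun X => 1 * indO X) = indO :> (pt R -> R).
  by apply/funext => X; rewrite mul1r.
have e2 : (fun X => 0 * indO X) = (fun=> 0) :> (pt R -> R).
  by apply/funext => X; rewrite mul0r.
have e3 : (fun t : R => 0 * t) = (fun=> 0) by apply/funext => t; rewrite mul0r.
have e4 : (fun t : R => 1 * t) = (fun t => t) by apply/funext => t; rewrite mul1r.
by rewrite /sing_ms /S e1 e2 e3 e4.
Qed.

(** Mass and energy fluxes are taken up by the growing line weights, the momentum flux by [w_p = 1].
    The velocity is supported on the open quadrant, so the accumulated mass carries no momentum,
    whereas the energy keeps the value [E0] on the piston. *)
Lemma singular_measure_sol (E0 : R) : 0 <= E0 -> measure_sol 1 1 E0 (sing_ms E0).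
Proof.
move=> E00.
have dok := density_ok_indO; have wok := @weight_ok_lin R.
have ok c q : 0 <= c -> 0 <= q -> sradon (S c q) /\ supp_Ob (S c q).
  move=> c0 q0; split; first by apply: sradon_DLs; [exact: dok|exact: wok].
  apply: supp_DLs; [exact: dok|exact: wok|].
  move=> X XO; rewrite /indO; case: ifP => [/andP[h1 h2]|]; last by rewrite mulr0.
  by case: XO; split; exact: ltW.
have mO := measurable_indO.
have mOb : measurable_fun setT (@indOb R).
  by apply: measurable_fun_ifT => //; apply: measurable_and; apply: measurable_fun_ler.
rewrite sing_msE /measure_sol; split; last split; last split; last split.
- have z0 := lexx (0 : R); have o0 := @ler01 R.
  split; first exact: ok.
  split; first exact: ok.
  split; first exact: ok.
  split; first exact: ok.
  split; first exact: ok.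
  by split; exact: ok.
- by move=> T _; exact: integrable_cst_itv.
- move=> phi phit phix C; have [bp bt bx] := C10_bcs C.
  have e1 := Omega_dt C; have e2 := Omega_dx C; have e3 := time_tr_dt C.
  rewrite -/(init_tr phi) in e1.
  rewrite /wdelta !spair_singular ?ler01 // !init_term // piston_term // e2 e3.
  rewrite /inOmega e1.
  by split; [|split]; lra.
- have sd c q c' q' (u : pt R -> R) (C : R) : 0 <= c -> 0 <= q -> 0 <= c' -> 0 <= q' ->
      measurable_fun setT u -> (forall X, `|u X| <= C) ->
      (forall X, c' * indO X = c * indO X * u X) ->
      (forall t, 0 <= t -> q' * t = q * t * u (t, 0)) -> sdens (S c' q') u (S c q).
    move=> c0 q0 c'0 q'0 mu uC h1 h2.
    by apply: sdens_DLs => //; [exact: dok|exact: wok|exact: dok|exact: wok|exists C].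
  have uB (X : pt R) : `|indO X| <= 1 by rewrite indOE; case: inOmega; rewrite ?normr1 ?normr0.
  have uu (X : pt R) : indO X * indO X = indO X.
    by rewrite indOE; case: inOmega; rewrite ?mulr1 ?mulr0.
  have uP (t : R) : indO (t, 0) = 0 by rewrite /indO /= ltxx andbF.
  split; first by apply: snonneg_DLs.
  split; first by apply: (sd _ _ _ _ _ 1) => // [X|t _]; rewrite ?uP ?mul1r ?uu ?mulr0 ?mul0r.
  split; first by apply: (sd _ _ _ _ _ 1) => // [X|t _]; rewrite ?uP ?mul1r ?uu ?mulr0 ?mul0r.
  split.
    apply: (sd _ _ _ _ _ E0) => //.
    + by apply: measurable_funM => //; exact: measurable_cst.
    + move=> X; rewrite /indOb; case: ifP => _; last by rewrite mulr0 normr0.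
      by rewrite mulr1 ger0_norm.
    + move=> X; rewrite mul1r /indO /indOb; case: ifP => [/andP[h1 h2]|]; last by rewrite mul0r mulr0.
      by rewrite !ltW //= mul1r mulr1.
    + by move=> t t0; rewrite /indOb /= t0 lexx /= mulr1 mul1r mulrC.
  split; first by apply: (sd _ _ _ _ _ 1) => // [X|t _]; rewrite ?uP -?mulrA ?uu ?mulr0 ?mul0r.
  split; first by apply: (sd _ _ _ _ _ 1) => // [X|t _]; rewrite ?uP -?mulrA ?uu ?mulr0 ?mul0r.
  split.
    move=> N mN nul B mB bB BN.
    rewrite (sval_DLs_off _ _ mB bB); [|exact: dok|exact: wok|by move=> t _; left; rewrite mul0r].
    by rewrite /Rintegral integral0_eq // => X _; rewrite mul0r.
  move=> X [r r0 nul].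
  case: (pselect (Omegab X)) => XO; last first.
    rewrite /indO /indOb; split.
      by case: ifP => // /andP[h1 h2]; case: XO; split; exact: ltW.
    by case: ifP => [/andP[h1 h2]|]; [case: XO|rewrite mulr0].
  exfalso; apply: (snull_no_mass (c := 1) (dok _ ler01) (wok _ ler01) _ _ XO r0 nul) => //.
  by move=> Y [Y1 Y2]; rewrite /indO Y1 Y2 mulr1.
- move=> O dr dp oO hr hp.
  (* [O] may meet the piston, where the mass has a singular part; Lax's condition concerns points of
     [Omega] only. *)
  have oOO : openS (O `&` Omega).
    move=> X [/oO[a a0 ha] /openS_Omega[b b0 hb]].
    exists (Num.min a b); first by rewrite lt_min a0.
    move=> Y []; rewrite !lt_min => /andP[h1 h2] /andP[h3 h4].
    by split; [apply: ha|apply: hb].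
  have gO (t : R) : 0 <= t -> 1 * t = 0 \/ ~ (O `&` Omega) (t, 0).
    by right => -[_ [_ /=]]; rewrite ltxx.
  have g0 (t : R) : 0 <= t -> 0 * t = 0 \/ ~ O (t, 0) by left; rewrite mul0r.
  have [N1 [mN1 N10 hN1]] := sL2_on_ae (dok _ ler01) (wok _ ler01) oOO (@subIsetl _ O Omega) gO hr.
  have [N2 [mN2 N20 hN2]] := sL2_on_ae (dok _ (lexx 0)) (wok _ (lexx 0)) oO (@subset_refl _ O) g0 hp.
  split.
    (* At [gamma = 1] the state law reads [p = 0], in agreement with the zero pressure measure. *)
    exists N2; split => // X /= h; apply: contrapT => h2; apply: h => OX.
    by rewrite hN2 // /press; lra.
  (* The state is constant inside [Omega]; the slope 0 is an arbitrary choice. *)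
  apply: (@lax_ok_two_states _ 1 O _ _ _ 0 (1, 1, E0) (1, 1, E0) N1) => // X OX OmX NX.
  have [X1 X2] := OmX.
  rewrite if_same hN1 //.
  by rewrite /indO /indOb X1 X2 !ltW //= !mulr1.
Qed.

End singular.

(** * Limits *)

Section wedge_limits.
Context {R : realType}.

Lemma Rintegral_bound_itv (f : R -> R) (a b e : R) : a <= b ->
  leb1.-integrable setT (EFin \o f) ->
  (forall x, a <= x <= b -> `|f x| <= e) ->
  (forall x, ~ (a <= x <= b) -> f x = 0) ->
  `|Rintegral leb1 setT f| <= e * (b - a).
Proof.
move=> ab fi fe f0.
have -> : Rintegral leb1 setT f = Rintegral leb1 `[a, b]%classic f.
  rewrite [RHS]Rintegral_mkcond; apply: eq_Rintegral => x _; rewrite /patch.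
  rewrite mem_setE in_itv /=; case: ifPn => // /negP; exact: f0.
have fi' : leb1.-integrable `[a, b]%classic (EFin \o f).
  by apply: (@integrableS _ _ _ _ setT).
apply: le_trans (le_normr_Rintegral _ fi') _ => //.
have -> : e * (b - a) = Rintegral leb1 `[a, b]%classic (fun=> e).
  by rewrite Rintegral_cst //; rewrite leb1_itv.
apply: le_Rintegral => //.
- exact: integrable_norm.
- by apply: continuous_integrable_itv => x; exact: cvg_cst.
Qed.

(** [M] enters twice: it bounds the duration, and it bounds the slice width [(z - z') * t] at time
    [t]. The estimate serves the Lipschitz bound and, with [z' = 0], the thin layer. *)
Lemma Rintegral_strip_bound (h : pt R -> R) (z' z e M : R) :
  bcs h -> 0 <= z' <= z -> 0 <= e -> 0 <= M ->
  (forall X, `|h X| <= e) ->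
  (forall X, ~ (0 <= X.1 <= M /\ - z * X.1 <= X.2 <= - z' * X.1) -> h X = 0) ->
  `|Rintegral leb2 setT h| <= e * M ^+ 2 * (z - z').
Proof.
move=> bh /andP[z'0 zz'] e0 M0 he h0.
have hi := bcs_integrable radon_leb2 bh.
have fin (t : R) : (\int[leb1]_x (h (t, x))%:E \is a fin_num)%E.
  by apply: integrable_fin_num => //; exact: (bcs1_integrable (bcs_pairt t bh)).
rewrite leb2_fubini_tx //.
have -> : e * M ^+ 2 * (z - z') = (e * ((z - z') * M)) * (M - 0) by lra.
apply: Rintegral_bound_itv => //.
- have := integrable_fubini_F hi; congr (_.-integrable _ _).
  by apply/funext => t; rewrite /= /fubini_F fineK.
- move=> t /andP[t0 tM].
  have zt : - z * t <= - z' * t by rewrite !mulNr lerN2 ler_wpM2r.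
  apply: (@le_trans _ _ (e * (- z' * t - (- z * t)))).
    apply: Rintegral_bound_itv => //; first exact: (bcs1_integrable (bcs_pairt t bh)).
    by move=> x hx; apply: h0 => /= -[_ k]; apply: hx.
  apply: ler_wpM2l => //.
  have -> : - z' * t - (- z * t) = (z - z') * t by lra.
  by apply: ler_wpM2l => //; lra.
- move=> t ht; rewrite /Rintegral integral0_eq // => x _.
  by rewrite h0 // => -[/= k _]; apply: ht.
Qed.

Variable phi : pt R -> R.
Hypotheses (cphi : cont2 phi) (sphi : csupp2 phi).

Let bphi : bcs phi. Proof. exact: cont2_bcs. Qed.

Let bR (s : R) : bcs (fun X => (wedgeR s X)%:R * phi X).
Proof. by apply: bcs_ind => //; exact: measurable_Omega_ge. Qed.

(** The two wedges are nested, and their difference is the strip between the two lines. *)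
Lemma intR_lipschitz : exists C : R, forall z z' : R, 0 <= z -> 0 <= z' ->
  `|intR (- z) phi - intR (- z') phi| <= C * `|z - z'|.
Proof.
have [_ [[C0 hC0] [M M0 hM]]] := bphi; pose C := `|C0|.
have hC X : `|phi X| <= C by apply: le_trans (hC0 X) (ler_norm _).
exists (C * M ^+ 2).
have main (z z' : R) : 0 <= z' -> z' <= z ->
    `|intR (- z) phi - intR (- z') phi| <= C * M ^+ 2 * (z - z').
  move=> z'0 zz'.
  have -> : intR (- z) phi - intR (- z') phi = Rintegral leb2 setT
      (fun X => (wedgeR (- z) X)%:R * phi X + (-1) * ((wedgeR (- z') X)%:R * phi X)).
    rewrite RintegralD //.
    - by rewrite RintegralZl // ?mulN1r //; exact: (bcs_integrable radon_leb2 (bR _)).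
    - exact: (bcs_integrable radon_leb2 (bR _)).
    - exact: (bcs_integrable radon_leb2 (bcsZ _ (bR _))).
  have hE X : (wedgeR (- z) X)%:R * phi X + (-1) * ((wedgeR (- z') X)%:R * phi X) =
     [&& 0 < X.1, X.2 < 0, - z * X.1 <= X.2 & X.2 < - z' * X.1]%:R * phi X.
    rewrite /wedgeR; case: (ltP 0 X.1) => t0 /=; last by rewrite !mul0r mulr0 addr0.
    case: (ltP X.2 0) => x0 /=; last by rewrite !mul0r mulr0 addr0.
    have [h|h] := ltP X.2 (- z' * X.1); first by rewrite /= andbT mul0r mulr0 addr0.
    have -> : - z * X.1 <= X.2.
      by apply: le_trans h; rewrite !mulNr lerN2; apply: ler_wpM2r => //; exact: ltW.
    by rewrite /= mul0r !mul1r mulN1r subrr.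
  have zz : 0 <= z' <= z by rewrite z'0.
  apply: (Rintegral_strip_bound _ zz (normr_ge0 _) (ltW M0)).
  - exact: bcsD (bR _) (bcsZ _ (bR _)).
  - move=> X; rewrite hE normrM; case: [&& _, _, _ & _]; rewrite ?normr1 ?mul1r //.
    by rewrite normr0 mul0r.
  - move=> X hX; rewrite hE.
    case: (pselect (`|X.1| <= M)) => XM; last by rewrite hM ?mulr0 // => -[].
    case: (ltP 0 X.1) => t0 /=; last by rewrite mul0r.
    case: (ltP X.2 0) => x0 /=; last by rewrite mul0r.
    case: (leP (- z * X.1) X.2) => h1 /=; last by rewrite mul0r.
    case: (ltP X.2 (- z' * X.1)) => h2 /=; last by rewrite mul0r.
    case: hX; split; first by rewrite ltW //= -(gtr0_norm t0).
    by rewrite h1 ltW.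
move=> z z' z0 z'0; case: (leP z' z) => h.
  by rewrite (ger0_norm (_ : 0 <= z - z')) ?subr_ge0 //; exact: main.
have h' := ltW h; rewrite distrC (distrC z) (ger0_norm (_ : 0 <= z' - z)) ?subr_ge0 //.
exact: main.
Qed.

(* The thin layer in front of the piston carries [z] times the time-weighted trace. *)
Lemma intR_small : forall e : R, 0 < e -> exists2 d : R, 0 < d & forall z : R, 0 < z < d ->
  `|intR (- z) phi - z * time_tr phi| <= e * z.
Proof.
move=> e e0; have [mphi [[C hC] [M M0 hM]]] := bphi.
(* The strip bound multiplies this oscillation by [M ^+ 2 * z], giving exactly [e * z]. *)
have e'0 : 0 < e / M ^+ 2 by rewrite divr_gt0 // exprn_gt0.
have [d d0 hd] := cont2_unif cphi sphi e'0.
exists (d / M); first by rewrite divr_gt0.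
move=> z /andP[z0 zd].
have zM : z * M < d by rewrite -ltr_pdivlMr.
(* Freezing [phi] at its piston value makes the layer integral exactly [z * time_tr phi]; the layer
   is thinner than [d], so the error is controlled by uniform continuity. *)
pose psi (X : pt R) := (wedgeR (- z) X)%:R * phi (X.1, 0).
have mw : measurable_fun setT (@wedgeR R (- z)) by exact: measurable_Omega_ge.
have psi0 (X : pt R) : M < `|X.1| -> phi (X.1, 0) = 0.
  by move=> h; apply: hM => -[/= k _]; move: h; rewrite ltNge k.
have inside X : wedgeR (- z) X -> `|X.1| <= M -> `|X.2| < d.
  move=> /and3P[t0 x0 xz]; rewrite gtr0_norm // => tM.
  rewrite ltr0_norm //; apply: le_lt_trans zM.
  by have := ler_wpM2l (ltW z0) tM; lra.
have bpsi : bcs psi.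
  split.
    apply: measurable_funM; first exact: measurable_ind.
    by apply: (measurableT_comp mphi); apply: measurable_fun_pair.
  split.
    exists C => X; rewrite /psi; case: wedgeR; rewrite ?mul1r // mul0r normr0.
    exact: le_trans (hC (0, 0)).
  exists (Num.max M d); first by rewrite lt_max M0.
  move=> X hX; rewrite /psi; case hw: (wedgeR _ _); last by rewrite mul0r.
  rewrite mul1r; apply: psi0; rewrite ltNge; apply/negP => tM; apply: hX.
  by split; rewrite le_max ?tM // (ltW (inside _ hw tM)) orbT.
have psiE : Rintegral leb2 setT psi = z * time_tr phi.
  rewrite leb2_fubini_tx // /time_tr -RintegralZl //; last first.
    apply: bcs1_integrable.
    have := bcs1M (bcs1_time bphi) (measurable_ind (P := fun t : measurableTypeR R => 0 < t) _).
    under [in X in _ -> X]eq_fun do rewrite mulrC.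
    apply; first exact: measurable_fun_ltr.
    by exists 1 => t _; case: (0 < t); rewrite ?normr1 ?normr0.
  apply: eq_Rintegral => t _; rewrite /psi /wedgeR /= Rintegral_indZ.
  case: (ltP 0 t) => [t0|t0]; last by rewrite !mul0r mulr0.
  rewrite !mul1r.
  have zt : - z * t <= 0 by have := mulr_ge0 (ltW z0) (ltW t0); lra.
  transitivity (Rintegral leb1 `[- z * t, 0[%classic (fun=> phi (t, 0))).
    by apply: Rintegral_ind => x; left; rewrite mem_setE in_itv /= andbC.
  rewrite Rintegral_cst // leb1_itv //=; lra.
rewrite -psiE.
have -> : intR (- z) phi - Rintegral leb2 setT psi = Rintegral leb2 setT
    (fun X => (wedgeR (- z) X)%:R * phi X + (-1) * psi X).
  rewrite RintegralD //.
  - by rewrite RintegralZl // ?mulN1r //; exact: (bcs_integrable radon_leb2 bpsi).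
  - exact: (bcs_integrable radon_leb2 (bR _)).
  - exact: (bcs_integrable radon_leb2 (bcsZ _ bpsi)).
have -> : e * z = e / M ^+ 2 * M ^+ 2 * (z - 0).
  by rewrite divfK ?subr0 // gt_eqF // exprn_gt0.
have hE X : (wedgeR (- z) X)%:R * phi X + (-1) * psi X =
    (wedgeR (- z) X)%:R * (phi X - phi (X.1, 0)) by rewrite /psi; lra.
have off X : M < `|X.1| -> phi X - phi (X.1, 0) = 0.
  by move=> h; rewrite psi0 // hM ?subrr // => -[k _]; move: h; rewrite ltNge k.
have zz : (0 : R) <= 0 <= z by rewrite lexx ltW.
apply: (Rintegral_strip_bound _ zz (ltW e'0) (ltW M0)).
- exact: bcsD (bR _) (bcsZ _ bpsi).
- move=> X; rewrite hE; case hw: (wedgeR _ _); last by rewrite mul0r normr0 ltW.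
  rewrite mul1r; case: (leP `|X.1| M) => XM; last by rewrite off // normr0 ltW.
  apply/ltW/(hd (X.1, 0) X) => /=; first by rewrite subrr normr0.
  by rewrite subr0; exact: inside hw XM.
- move=> X hX; rewrite hE; case hw: (wedgeR _ _); last by rewrite mul0r.
  case: (leP `|X.1| M) => XM; last by rewrite off // mulr0.
  case: hX; move: hw XM => /and3P[t0 x0 xz]; rewrite gtr0_norm // => XM.
  by rewrite XM xz ltW //= oppr0 mul0r ltW.
Qed.

End wedge_limits.

(** * Weak convergence of two-state measures *)

Section convergence.
Context {R : realType}.

Lemma cvg_conv_right (F : R -> R) (a L : R) :
  F y @[y --> a^'+] --> L -> conv_right F a L.
Proof.
move=> /cvgrPdist_lt FL e e0; have [d /= d0 h] := FL e e0.
exists d => // y /andP[ay yd]; rewrite distrC; apply: h => //=.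
by rewrite /ball_ ltr0_norm; lra.
Qed.

Lemma wconv_right_ext (mu mu' : R -> smeas) (a : R) (mu0 : smeas) :
  (forall y, a < y -> mu y = mu' y) -> wconv_right mu' a mu0 -> wconv_right mu a mu0.
Proof.
move=> e h phi cp sp eps eps0; have [d d0 H] := h phi cp sp eps eps0.
by exists d => // y /[dup] /andP[ay _] /H; rewrite e.
Qed.

Lemma cvg_ext_right (F G : R -> R) (a L : R) : (forall y, a < y -> F y = G y) ->
  G y @[y --> a^'+] --> L -> F y @[y --> a^'+] --> L.
Proof.
move=> FG; apply: cvg_trans; apply: near_eq_cvg; near=> y.
by rewrite FG //; near: y; exact: nbhs_right_gt.
Unshelve. all: by end_near. Qed.

Lemma spair_pc1 (z a b : R) (phi : pt R -> R) : 0 <= z -> 0 <= a -> 0 <= b -> bcs phi ->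
  spair (DLs (pc1 (- z) a b) (fun=> 0)) phi =
  a * Rintegral leb2 setT (fun X => (inOmega X)%:R * phi X) +
  (b - a) * intR (- z) phi.
Proof.
move=> z0 a0 b0 bp; have s0 : - z <= 0 by lra.
rewrite spair_DLs0 //; last exact: density_ok_pc1.
by rewrite Rintegral_pc1 // -(intLR s0 bp); lra.
Qed.

Lemma wconv_right_two_state (z a b : R -> R) (y0 z0 a0 b0 : R) :
  (forall y, y0 < y -> [/\ 0 <= z y, 0 <= a y & 0 <= b y]) ->
  0 <= z0 -> 0 <= a0 -> 0 <= b0 ->
  z y @[y --> y0^'+] --> z0 -> a y @[y --> y0^'+] --> a0 -> b y @[y --> y0^'+] --> b0 ->
  wconv_right (fun y => DLs (pc1 (- z y) (a y) (b y)) (fun=> 0)) y0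
    (DLs (pc1 (- z0) a0 b0) (fun=> 0)).
Proof.
move=> pos z00 a00 b00 cz ca cb phi cp sp; have bp := cont2_bcs cp sp.
apply: cvg_conv_right; rewrite spair_pc1 //.
apply: (@cvg_ext_right _ (fun y => a y * Rintegral leb2 setT (fun X => (inOmega X)%:R * phi X) +
  (b y - a y) * intR (- z y) phi)).
  by move=> y /pos[h1 h2 h3]; rewrite spair_pc1.
have [C hC] := intR_lipschitz cp sp.
have cG : intR (- z y) phi @[y --> y0^'+] --> intR (- z0) phi.
  apply/cvgrPdist_lt => e e0.
  have C1 : 0 < `|C| + 1 by rewrite ltr_pwDr.
  have e1 : 0 < e / (`|C| + 1) by rewrite divr_gt0.
  near=> y; have [zy _ _] : [/\ 0 <= z y, 0 <= a y & 0 <= b y].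
    by apply: pos; near: y; exact: nbhs_right_gt.
  apply: le_lt_trans (hC z0 (z y) z00 zy) _.
  apply: (@le_lt_trans _ _ ((`|C| + 1) * `|z0 - z y|)).
    by apply: ler_wpM2r => //; have := ler_norm C; lra.
  rewrite mulrC -ltr_pdivlMr //.
  by near: y; move/cvgrPdist_lt: cz; apply.
by apply: cvgD; apply: cvgM => //; [exact: cvg_cst|exact: cvgB].
Unshelve. all: by end_near. Qed.

(** [b] may be unbounded, so the layer term is regrouped as [(b * z - a * z)] times [intR / z], a
    product of two convergent factors. The limit [q] of [b * z] becomes the rate of the line
    weight. *)
Lemma wconv_right_singular (z a b : R -> R) (y0 a0 q : R) :
  (forall y, y0 < y -> [/\ 0 < z y, 0 <= a y & 0 <= b y]) ->
  0 <= a0 -> 0 <= q ->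
  z y @[y --> y0^'+] --> 0 -> a y @[y --> y0^'+] --> a0 ->
  (b y * z y) @[y --> y0^'+] --> q ->
  wconv_right (fun y => DLs (pc1 (- z y) (a y) (b y)) (fun=> 0)) y0
    (DLs (fun X => a0 * indO X) (fun t => q * t)).
Proof.
move=> pos a00 q0 cz ca cb phi cp sp; have bp := cont2_bcs cp sp.
apply: cvg_conv_right; rewrite spair_singular //.
apply: (@cvg_ext_right _ (fun y => a y * Rintegral leb2 setT (fun X => (inOmega X)%:R * phi X) +
  (b y * z y - a y * z y) * (intR (- z y) phi / z y))).
  move=> y /pos[h1 h2 h3]; rewrite (spair_pc1 (ltW h1) h2 h3 bp); congr (_ + _).
  by field; rewrite gt_eqF.
have cG : (intR (- z y) phi / z y) @[y --> y0^'+] --> time_tr phi.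
  apply/cvgrPdist_lt => e e0.
  have e2 : 0 < e / 2 by lra.
  have [d d0 hd] := intR_small cp sp e2.
  near=> y; have [zy _ _] : [/\ 0 < z y, 0 <= a y & 0 <= b y].
    by apply: pos; near: y; exact: nbhs_right_gt.
  have zd : 0 < z y < d.
    rewrite zy /=; have : `|0 - z y| < d by near: y; move/cvgrPdist_lt: cz; apply.
    by rewrite sub0r normrN gtr0_norm.
  have h := hd _ zd.
  have -> : time_tr phi - intR (- z y) phi / z y = - ((intR (- z y) phi - z y * time_tr phi) / z y).
    by field; rewrite gt_eqF.
  rewrite normrN normrM normfV (gtr0_norm zy) ltr_pdivrMr //.
  by apply: le_lt_trans h _; rewrite ltr_pM2r //; lra.
have e : q * time_tr phi = (q - a0 * 0) * time_tr phi by rewrite mulr0 subr0.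
rewrite e; apply: cvgD; apply: cvgM => //; first exact: cvg_cst.
by apply: cvgB => //; exact: cvgM.
Unshelve. all: by end_near. Qed.

Lemma piston_pressure_conv (p : R -> R) (y0 L T : R) : 0 < T ->
  p y @[y --> y0^'+] --> L ->
  conv_right (fun y => Rintegral leb1 `[0, T]%classic (fun=> `|p y - L|)) y0 0.
Proof.
move=> T0 cpL; apply: cvg_conv_right.
apply: (@cvg_ext_right _ (fun y => `|p y - L| * T)).
  by move=> y _; rewrite Rintegral_cst // leb1_itv ?(ltW T0) // subr0.
rewrite (_ : 0 = `|L - L| * T); last by rewrite subrr normr0 mul0r.
apply: cvgM; last exact: cvg_cst.
by apply: cvg_norm; apply: cvgB => //; exact: cvg_cst.
Qed.

End convergence.

(** * The shock state *)

Section shock_state.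
Context {R : realType}.
Implicit Types gam : R.

Definition shockB gam : R := (3 - gam) / 2.
Definition shockA (gam E0 : R) : R := (gam - 1) * (E0 + p0 gam E0).
(* The shock speed [- sigma] as the positive root of [z ^ 2 + B z = A]. *)
Definition shock_speed (gam E0 : R) : R :=
  (Num.sqrt (shockB gam ^+ 2 + 4 * shockA gam E0) - shockB gam) / 2.

Lemma p0_ge0 (gam E0 : R) : 1 <= gam -> 1 / 2 <= E0 -> 0 <= p0 gam E0.
Proof. by move=> g e; rewrite /p0 mulr_ge0 //; lra. Qed.

Lemma shockA_gt0 (gam E0 : R) : 1 < gam -> 1 / 2 <= E0 -> 0 < shockA gam E0.
Proof. by move=> g e; rewrite mulr_gt0 //; have := p0_ge0 (ltW g) e; lra. Qed.

Lemma shock_speedE (gam E0 : R) : 1 < gam -> 1 / 2 <= E0 ->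
  let z := shock_speed gam E0 in 0 < z /\ z ^+ 2 + shockB gam * z = shockA gam E0.
Proof.
move=> g e /=; have A0 := shockA_gt0 g e.
set B := shockB gam; set A := shockA gam E0 in A0 *.
have B2 : 0 <= B ^+ 2 by exact: sqr_ge0.
pose S := Num.sqrt (B ^+ 2 + 4 * A).
have S2 : S ^+ 2 = B ^+ 2 + 4 * A by apply: sqr_sqrtr; lra.
(* [B] is negative for [gamma > 3]; comparison through its absolute value covers both signs. *)
have BS : B < S.
  apply: le_lt_trans (ler_norm B) _; rewrite -sqrtr_sqr ltr_sqrt; lra.
rewrite /shock_speed -/B -/A -/S; split; first by lra.
have -> : ((S - B) / 2) ^+ 2 + B * ((S - B) / 2) = (S ^+ 2 - B ^+ 2) / 4 by field.
by rewrite S2; field.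
Qed.

(** [E0] cancels from [p0 + 1 - (gamma - 1) E0], leaving [shockB], and the radicand becomes the
    discriminant of the quadratic. The rest is [z * (z + B) = A], that is [(z + B) / A = 1 / z]. *)
Lemma rho1E (gam E0 : R) : 1 < gam -> 1 / 2 <= E0 ->
  let z := shock_speed gam E0 in rho1 gam E0 = (1 + z) / z.
Proof.
move=> g e z; have [z0 zE] := shock_speedE g e; have A0 := shockA_gt0 g e.
rewrite -/z in z0 zE.
have zn : z != 0 by rewrite gt_eqF.
have An : shockA gam E0 != 0 by rewrite gt_eqF.
rewrite /rho1.
have -> : p0 gam E0 + 1 - (gam - 1) * E0 = shockB gam by rewrite /p0 /shockB; field.
have -> : ((gam - 1) * E0 - p0 gam E0 - 1) ^+ 2 + 4 * (gam - 1) * (E0 + p0 gam E0) =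
    shockB gam ^+ 2 + 4 * shockA gam E0 by rewrite /shockA /p0 /shockB; field.
have -> : 2 * (gam - 1) * (E0 + p0 gam E0) = 2 * shockA gam E0 by rewrite /shockA; ring.
have -> : Num.sqrt (shockB gam ^+ 2 + 4 * shockA gam E0) = 2 * z + shockB gam.
  by rewrite /z /shock_speed; field.
have -> : (1 + z) / z = 1 + z^-1 by rewrite mulrDl divff // mul1r addrC.
congr (_ + _); apply: (mulIf zn); rewrite mulVf //.
apply: (mulIf An); rewrite mul1r -[RHS]zE; field.
by rewrite An.
Qed.

Lemma sigmaE (gam E0 : R) : 1 < gam -> 1 / 2 <= E0 -> sigma gam E0 = - shock_speed gam E0.
Proof.
move=> g e; have [z0 _] := shock_speedE g e; rewrite /sigma rho1E //.
have zn : shock_speed gam E0 != 0 by rewrite gt_eqF.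
have -> : (1 + shock_speed gam E0) / shock_speed gam E0 - 1 = (shock_speed gam E0)^-1 by field.
by rewrite div1r invrK.
Qed.

Lemma p1E (gam E0 : R) : 1 < gam -> 1 / 2 <= E0 ->
  p1 gam E0 = p0 gam E0 + 1 + shock_speed gam E0.
Proof.
by move=> g e; have := sigmaE g e; rewrite /sigma /p1 => /oppr_inj ->.
Qed.

Lemma rho1E1 (gam E0 : R) : 1 < gam -> 1 / 2 <= E0 ->
  let z := shock_speed gam E0 in
  rho1 gam E0 * E1 gam E0 = ((1 + z) * E0 + p0 gam E0) / z.
Proof.
move=> g e z; have [z0 _] := shock_speedE g e; rewrite -/z in z0.
rewrite /E1 rho1E // -/z; field.
by rewrite !gt_eqF //; lra.
Qed.

Lemma press_left (gam E0 : R) : press gam 1 1 E0 = p0 gam E0.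
Proof. by rewrite /press /p0 expr1n mulr1. Qed.

(** The state law and the momentum balance each prescribe the pressure behind the shock; their
    agreement is the quadratic relation for [z]. *)
Lemma press_right (gam E0 : R) : 1 < gam -> 1 / 2 <= E0 ->
  press gam (rho1 gam E0) 0 (E1 gam E0) = p0 gam E0 + 1 + shock_speed gam E0.
Proof.
move=> g e; have [z0 zE] := shock_speedE g e.
set z := shock_speed gam E0 in z0 zE *.
rewrite /press expr0n mul0r subr0 -mulrA rho1E1 // -/z.
apply: (mulIf (_ : z != 0)); first by rewrite gt_eqF.
rewrite mulrA divfK ?gt_eqF //.
have -> : (p0 gam E0 + 1 + z) * z = (p0 gam E0 + 1 - shockB gam) * z + (z ^+ 2 + shockB gam * z) by ring.
by rewrite zE /shockA /shockB /p0; field.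
Qed.

(** A 1-shock: relative to the shock the gas ahead, of speed [1 + z], is supersonic and the gas
    behind, of speed [z], is subsonic. Both comparisons of squares follow from the quadratic
    relation once [A] is written as [gamma p0 + (gamma - 1) / 2]. *)
Lemma shock_lax (gam E0 : R) : 1 < gam -> 1 / 2 <= E0 ->
  lax_adm gam (1, 1, E0) (rho1 gam E0, 0, E1 gam E0) (sigma gam E0).
Proof.
move=> g e; have [z0 zE] := shock_speedE g e; have P0 := p0_ge0 (ltW g) e.
left; rewrite sigmaE // /lam1 /lam2 /sndspd /= press_right // press_left rho1E //.
set z := shock_speed gam E0 in z0 zE *.
rewrite /shockA /shockB in zE.
have z1 : 0 < 1 + z by lra.
have pE : p0 gam E0 = (gam - 1) * (E0 - 1 / 2) by [].
have key1 : z * (1 + z) < gam * (p0 gam E0 + 1 + z).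
  have : (gam - 1) * (E0 + p0 gam E0) = gam * p0 gam E0 + (gam - 1) / 2 by rewrite pE; field.
  have gz : 0 < gam * z by rewrite mulr_gt0 //; lra.
  by nra.
have key2 : gam * p0 gam E0 < (1 + z) ^+ 2.
  have : (gam - 1) * (E0 + p0 gam E0) = gam * p0 gam E0 + (gam - 1) / 2 by rewrite pE; field.
  have gz : 0 < gam * z by rewrite mulr_gt0 //; lra.
  by nra.
split; last by lra.
apply/andP; split.
  rewrite sub0r ltrN2.
  have -> : gam * (p0 gam E0 + 1 + z) / ((1 + z) / z) = gam * (p0 gam E0 + 1 + z) * z / (1 + z).
    by field; rewrite !gt_eqF.
  have pos : z ^+ 2 < gam * (p0 gam E0 + 1 + z) * z / (1 + z).
    rewrite ltr_pdivlMr //; have -> : z ^+ 2 * (1 + z) = z * (1 + z) * z by ring.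
    by rewrite ltr_pM2r.
  rewrite -[X in X < _](gtr0_norm z0) -sqrtr_sqr ltr_sqrt //.
  by apply: le_lt_trans pos; exact: sqr_ge0.
rewrite divr1; suff : Num.sqrt (gam * p0 gam E0) < 1 + z by lra.
rewrite -[X in _ < X](gtr0_norm z1) -sqrtr_sqr ltr_sqrt //.
by rewrite exprn_gt0.
Qed.

Lemma shock_solution (gam E0 : R) : 1 < gam -> 1 / 2 <= E0 ->
  weak_sol gam 1 E0 (fun X => (solB gam E0 X).1.1) (fun X => (solB gam E0 X).1.2)
    (fun X => (solB gam E0 X).2) /\
  measure_sol gam 1 E0 (induced_ms gam (solB gam E0) (fun _ => p1 gam E0)).
Proof.
move=> g e; have [z0 zE] := shock_speedE g e; have P0 := p0_ge0 (ltW g) e.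
have sE := sigmaE g e; have rE := rho1E g e; have reE := rho1E1 g e.
have pE := press_right g e; have lE := press_left gam E0; have lx := shock_lax g e.
rewrite /= in rE reE.
set z := shock_speed gam E0 in z0 zE sE rE reE pE.
have s0 : sigma gam E0 < 0 by rewrite sE; lra.
have r0 : 0 < rho1 gam E0 by rewrite rE divr_gt0 //; lra.
have E00 : 0 <= E0 by lra.
have re0 : 0 < rho1 gam E0 * E1 gam E0.
  by rewrite reE divr_gt0 // ltr_wpDr // mulr_gt0 //; lra.
have e0 : 0 <= E1 gam E0 by move: re0; rewrite pmulr_rgt0 // => /ltW.
have zn : z != 0 by rewrite gt_eqF.
have pL0 : 0 <= press gam 1 1 E0 by rewrite lE.
have pR0 : 0 <= press gam (rho1 gam E0) 0 (E1 gam E0) by rewrite pE; lra.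
have RH1 : 1 = sigma gam E0 * (1 - rho1 gam E0) by rewrite sE rE; field.
have RH2 : 1 + press gam 1 1 E0 - press gam (rho1 gam E0) 0 (E1 gam E0) = sigma gam E0.
  by rewrite lE pE sE; ring.
have RH3 : E0 + press gam 1 1 E0 = sigma gam E0 * (E0 - rho1 gam E0 * E1 gam E0).
  by rewrite lE sE reE; field.
split; first exact: two_state_weak_sol.
have := two_state_measure_sol s0 r0 E00 e0 pL0 pR0 RH1 RH2 RH3 lx.
by rewrite pE p1E.
Qed.

Lemma induced_ms_solB (gam E0 : R) (wp : R -> R) : 1 < gam -> 1 / 2 <= E0 ->
  let z := shock_speed gam E0 in let p := p0 gam E0 in
  let Z a b := DLs (pc1 (- z) a b) (fun _ : R => 0) in
  induced_ms gam (solB gam E0) wp =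
  MSD (Z 1 ((1 + z) / z)) (Z 1 0) (Z 1 0) (Z E0 (((1 + z) * E0 + p) / z)) (Z E0 0)
    (Z p 0) (Z p (p + 1 + z)) wp (pc1 (- z) 1 0) (pc1 (- z) E0 (E1 gam E0)).
Proof.
move=> g e /=; rewrite /solB induced_ms_pc3 press_left press_right // rho1E1 //.
by rewrite rho1E // sigmaE.
Qed.

(** With [p0 = 0] the discriminant is the perfect square of [(gamma + 1) / 2]. *)
Lemma shock_speed_half gam : 1 < gam -> shock_speed gam (1 / 2) = (gam - 1) / 2.
Proof.
move=> g; rewrite /shock_speed.
have -> : shockB gam ^+ 2 + 4 * shockA gam (1 / 2) = ((gam + 1) / 2) ^+ 2.
  by rewrite /shockB /shockA /p0; field.
rewrite sqrtr_sqr ger0_norm; last by lra.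
by rewrite /shockB; field.
Qed.

Lemma solB0E gam : 1 < gam -> solB0 gam = solB gam (1 / 2).
Proof.
move=> g; have e := lexx (1 / 2 : R).
rewrite /solB0 /solB sigmaE // rho1E // shock_speed_half //.
have -> : E1 gam (1 / 2) = 1 / 2.
  have := rho1E1 g e; rewrite /= rho1E // shock_speed_half // /p0 => h.
  have r0 : (1 + (gam - 1) / 2) / ((gam - 1) / 2) != 0.
    by rewrite gt_eqF // divr_gt0 //; lra.
  by apply: (mulfI r0); rewrite h; field; lra.
congr (pc3 _ _ (_, _, _)); first by field.
by field; lra.
Qed.

Lemma p1_half gam : 1 < gam -> p1 gam (1 / 2) = (gam + 1) / 2.
Proof. by move=> g; rewrite p1E // shock_speed_half // /p0; field. Qed.

End shock_state.

(** * Continuity of the shock parameters and the two limits *)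

Section shock_limits.
Context {R : realType}.

Lemma continuous_right (F : R -> R) (a : R) : continuous F -> F y @[y --> a^'+] --> F a.
Proof. by move=> cF; exact/cvg_at_right_filter/cF. Qed.

Lemma continuous_sqrt_quadratic (B A : R -> R) : continuous B -> continuous A ->
  continuous (fun y => (Num.sqrt (B y ^+ 2 + 4 * A y) - B y) / 2).
Proof.
move=> cB cA y; apply: cvgM; last exact: cvg_cst.
apply: cvgB; last exact: cB.
apply: (continuous_comp (f := fun y => B y ^+ 2 + 4 * A y)); last exact: sqrt_continuous.
apply: cvgD; first by rewrite /=; under eq_fun do rewrite expr2; rewrite expr2; apply: cvgM; exact: cB.
by apply: cvgM; [exact: cvg_cst|exact: cA].
Qed.

Lemma continuous_p0_energy (gam : R) : continuous (p0 gam).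
Proof.
move=> y; apply: cvgM; first exact: cvg_cst.
by apply: cvgB; [exact: cvg_id|exact: cvg_cst].
Qed.

Lemma continuous_p0_gamma (E0 : R) : continuous (fun gam => p0 gam E0).
Proof.
move=> y; apply: cvgM; last exact: cvg_cst.
by apply: cvgB; [exact: cvg_id|exact: cvg_cst].
Qed.

Lemma continuous_shock_speed_energy (gam : R) : continuous (shock_speed gam).
Proof.
apply: continuous_sqrt_quadratic => y; first exact: cvg_cst.
apply: cvgM; first exact: cvg_cst.
by apply: cvgD; [exact: cvg_id|exact: continuous_p0_energy].
Qed.

Lemma continuous_shock_speed_gamma (E0 : R) : continuous (fun gam => shock_speed gam E0).
Proof.
apply: continuous_sqrt_quadratic => y.
  apply: cvgM; last exact: cvg_cst.
  by apply: cvgB; [exact: cvg_cst|exact: cvg_id].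
apply: cvgM; first by apply: cvgB; [exact: cvg_id|exact: cvg_cst].
by apply: cvgD; [exact: cvg_cst|exact: continuous_p0_gamma].
Qed.

(** At [gamma = 1] one has [A = 0] and [B = 1]: the shock collapses onto the piston. Unlike [rho1],
    the formula for [z] remains regular there. *)
Lemma shock_speed_gamma1 (E0 : R) : shock_speed 1 E0 = 0.
Proof.
rewrite /shock_speed /shockA subrr mul0r mulr0 addr0.
have -> : shockB (1 : R) = 1 by rewrite /shockB; field.
by rewrite expr1n sqrtr1 subrr mul0r.
Qed.

Lemma energy_limit (gam : R) : 1 < gam ->
  msol_conv_right (fun E0 => induced_ms gam (solB gam E0) (fun _ => p1 gam E0))
    (1 / 2) (induced_ms gam (solB0 gam) (fun _ => (gam + 1) / 2)).
Proof.
move=> g; have e := lexx (1 / 2 : R).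
rewrite solB0E // induced_ms_solB // -(p1_half g).
have [zh _] := shock_speedE g e.
have hz y : 1 / 2 < y -> 0 < shock_speed gam y.
  by move=> /ltW h; have [] := shock_speedE g h.
have hp y : 1 / 2 <= y -> 0 <= p0 gam y by move=> h; apply: p0_ge0 => //; exact: ltW.
have cz : shock_speed gam y @[y --> (1 / 2)^'+] --> shock_speed gam (1 / 2).
  exact/continuous_right/continuous_shock_speed_energy.
have cp : p0 gam y @[y --> (1 / 2)^'+] --> p0 gam (1 / 2).
  exact/continuous_right/continuous_p0_energy.
have cid : y @[y --> (1 / 2 : R)^'+] --> (1 / 2 : R).
  by apply: (continuous_right (F := id)) => x; exact: cvg_id.
have cc (c : R) : c @[y --> (1 / 2 : R)^'+] --> c by exact: cvg_cst.
have ciz : (shock_speed gam y)^-1 @[y --> (1 / 2)^'+] --> (shock_speed gam (1 / 2))^-1.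
  by apply: cvgV => //; rewrite gt_eqF.
have cz1 : 1 + shock_speed gam y @[y --> (1 / 2)^'+] --> 1 + shock_speed gam (1 / 2).
  exact: cvgD.
have lim (a b : R -> R) :
    (forall y, 1 / 2 <= y -> 0 < shock_speed gam y -> 0 <= p0 gam y -> 0 <= a y /\ 0 <= b y) ->
    a y @[y --> (1 / 2)^'+] --> a (1 / 2) -> b y @[y --> (1 / 2)^'+] --> b (1 / 2) ->
    wconv_right (fun y => DLs (pc1 (- shock_speed gam y) (a y) (b y)) (fun=> 0)) (1 / 2)
      (DLs (pc1 (- shock_speed gam (1 / 2)) (a (1 / 2)) (b (1 / 2))) (fun=> 0)).
  move=> pos ca cb.
  have [p1 p2] := pos _ e zh (hp _ e).
  apply: wconv_right_two_state => //; last exact: ltW.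
  move=> y hy; have [q1 q2] := pos _ (ltW hy) (hz _ hy) (hp _ (ltW hy)).
  by split=> //; apply/ltW/hz.
have ext : forall y, 1 / 2 < y -> induced_ms gam (solB gam y) (fun=> p1 gam y) = _ :=
  fun y hy => induced_ms_solB (fun=> p1 gam y) g (ltW hy).
split; [|split; [|split; [|split; [|split; [|split; [|split]]]]]].
- apply: wconv_right_ext => [y /ext->|] /=; first by [].
  apply: (lim (fun=> 1) (fun y => (1 + shock_speed gam y) / shock_speed gam y)) => //.
    by move=> y hy z0 _; split=> //; apply: divr_ge0; lra.
  exact: cvgM.
- apply: wconv_right_ext => [y /ext->|] /=; first by [].
  exact: (lim (fun=> 1) (fun=> 0)).
- apply: wconv_right_ext => [y /ext->|] /=; first by [].
  exact: (lim (fun=> 1) (fun=> 0)).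
- apply: wconv_right_ext => [y /ext->|] /=; first by [].
  apply: (lim id (fun y => ((1 + shock_speed gam y) * y + p0 gam y) / shock_speed gam y)) => //.
    move=> y hy z0 p00; split; first by rewrite /=; lra.
    by apply: divr_ge0; [apply: addr_ge0 => //; apply: mulr_ge0; lra|lra].
  by apply: cvgM => //; apply: cvgD => //; exact: cvgM.
- apply: wconv_right_ext => [y /ext->|] /=; first by [].
  by apply: (lim id (fun=> 0)) => // y hy _ _; split=> //=; lra.
- apply: wconv_right_ext => [y /ext->|] /=; first by [].
  exact: (lim (p0 gam) (fun=> 0)).
- apply: wconv_right_ext => [y /ext->|] /=; first by [].
  apply: (lim (p0 gam) (fun y => p0 gam y + 1 + shock_speed gam y)) => //.
    by move=> y hy z0 p00; split=> //; lra.
  by apply: cvgD => //; exact: cvgD.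
- move=> T T0 /=; apply: piston_pressure_conv => //.
  apply: (cvg_ext_right (G := fun y => p0 gam y + 1 + shock_speed gam y)).
    by move=> y hy; rewrite p1E // ltW.
  by rewrite p1E //; apply: cvgD => //; exact: cvgD.
Qed.

Lemma gamma_limit (E0 : R) : 1 / 2 < E0 ->
  msol_conv_right (fun gam => induced_ms gam (solB gam E0) (fun _ => p1 gam E0))
    1 (sing_ms E0).
Proof.
move=> eh; have e := ltW eh; have E00 : 0 <= E0 by lra.
rewrite sing_msE.
have hz y : 1 < y -> 0 < shock_speed y E0 by move=> h; have [] := shock_speedE h e.
have hp y : 1 < y -> 0 <= p0 y E0 by move=> h; apply: p0_ge0 => //; exact: ltW.
have cz : shock_speed y E0 @[y --> 1^'+] --> 0.
  rewrite -(shock_speed_gamma1 E0); apply: (continuous_right (F := fun g => shock_speed g E0)).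
  exact: continuous_shock_speed_gamma.
have cp : p0 y E0 @[y --> 1^'+] --> 0.
  have -> : 0 = p0 1 E0 by rewrite /p0 subrr mul0r.
  apply: (continuous_right (F := fun g => p0 g E0)); exact: continuous_p0_gamma.
have cc (c : R) : c @[y --> (1 : R)^'+] --> c by exact: cvg_cst.
have ext : forall y, 1 < y -> induced_ms y (solB y E0) (fun=> p1 y E0) = _ :=
  fun y hy => induced_ms_solB (fun=> p1 y E0) hy e.
(* [bz y] is the mass collected per unit time between the shock and the piston. *)
have lim (a b bz : R -> R) (a0 q : R) :
    (forall y, 1 < y -> 0 < shock_speed y E0 -> 0 <= p0 y E0 ->
      [/\ 0 <= a y, 0 <= b y & b y * shock_speed y E0 = bz y]) ->
    0 <= a0 -> 0 <= q ->
    a y @[y --> 1^'+] --> a0 -> bz y @[y --> 1^'+] --> q ->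
    wconv_right (fun y => DLs (pc1 (- shock_speed y E0) (a y) (b y)) (fun=> 0)) 1
      (DLs (fun X => a0 * indO X) (fun t => q * t)).
  move=> pos a00 q0 ca cb; apply: wconv_right_singular => //.
    move=> y hy; have [q1 q2 _] := pos _ hy (hz _ hy) (hp _ hy).
    by split=> //; exact: hz.
  apply: cvg_ext_right cb => y hy.
  by have [] := pos _ hy (hz _ hy) (hp _ hy).
have cz1 : 1 + shock_speed y E0 @[y --> 1^'+] --> (1 : R).
  by have h := cvgD (cc 1) cz; rewrite addr0 in h; exact: h.
have cp1 : p0 y E0 + 1 + shock_speed y E0 @[y --> 1^'+] --> (1 : R).
  by have h := cvgD (cvgD cp (cc 1)) cz; rewrite add0r addr0 in h; exact: h.
have o0 := @ler01 R; have z0 := lexx (0 : R).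
split; [|split; [|split; [|split; [|split; [|split; [|split]]]]]].
- apply: wconv_right_ext => [y /ext->|] /=; first by [].
  apply: (lim (fun=> 1) (fun y => (1 + shock_speed y E0) / shock_speed y E0)
    (fun y => 1 + shock_speed y E0)) => //.
  move=> y hy zy _; split=> //; first by apply: divr_ge0; lra.
  by rewrite divfK // gt_eqF.
- apply: wconv_right_ext => [y /ext->|] /=; first by [].
  by apply: (lim (fun=> 1) (fun=> 0) (fun=> 0)) => // y _ _ _; rewrite mul0r.
- apply: wconv_right_ext => [y /ext->|] /=; first by [].
  by apply: (lim (fun=> 1) (fun=> 0) (fun=> 0)) => // y _ _ _; rewrite mul0r.
- apply: wconv_right_ext => [y /ext->|] /=; first by [].
  apply: (lim (fun=> E0) (fun y => ((1 + shock_speed y E0) * E0 + p0 y E0) / shock_speed y E0)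
    (fun y => (1 + shock_speed y E0) * E0 + p0 y E0)) => //.
    move=> y hy zy p00; split=> //; last by rewrite divfK // gt_eqF.
    by apply: divr_ge0; [apply: addr_ge0 => //; apply: mulr_ge0; lra|lra].
  by have h := cvgD (cvgM cz1 (cc E0)) cp; rewrite mul1r addr0 in h; exact: h.
- apply: wconv_right_ext => [y /ext->|] /=; first by [].
  by apply: (lim (fun=> E0) (fun=> 0) (fun=> 0)) => // y _ _ _; rewrite mul0r.
- apply: wconv_right_ext => [y /ext->|] /=; first by [].
  by apply: (lim (fun y => p0 y E0) (fun=> 0) (fun=> 0)) => // y _ _ ?; rewrite mul0r.
- apply: wconv_right_ext => [y /ext->|] /=; first by [].
  (* The pressure in the layer tends to 1, but the layer has vanishing width, so the pressure
     measure tends to 0; the wall pressure [w_p] keeps the limit 1. *)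
  apply: (lim (fun y => p0 y E0) (fun y => p0 y E0 + 1 + shock_speed y E0)
    (fun y => (p0 y E0 + 1 + shock_speed y E0) * shock_speed y E0)) => //.
    by move=> y hy zy p00; split=> //; lra.
  by have h := cvgM cp1 cz; rewrite mul1r in h; exact: h.
- move=> T T0 /=; apply: piston_pressure_conv => //.
  apply: (cvg_ext_right (G := fun y => p0 y E0 + 1 + shock_speed y E0)).
    by move=> y hy; rewrite p1E.
  exact: cp1.
Qed.

End shock_limits.

Theorem mainTheorem1 (R : realType) :
  (* the rushing solution is an integral weak solution and induces a
     measure solution, for every gamma > 1 and E0 > 1/2 *)
  (forall gam E0 : R, 1 < gam -> 1 / 2 < E0 ->
     weak_sol gam 1 E0 (fun X => (solB gam E0 X).1.1) (fun X => (solB gam E0 X).1.2)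
                       (fun X => (solB gam E0 X).2) /\
     measure_sol gam 1 E0 (induced_ms gam (solB gam E0) (fun _ => p1 gam E0))) /\
  (* Case 1 : gamma > 1 fixed, E0 -> 1/2^+ *)
  (forall gam : R, 1 < gam ->
     weak_sol gam 1 (1 / 2) (fun X => (solB0 gam X).1.1) (fun X => (solB0 gam X).1.2)
                            (fun X => (solB0 gam X).2) /\
     measure_sol gam 1 (1 / 2) (induced_ms gam (solB0 gam) (fun _ => (gam + 1) / 2)) /\
     msol_conv_right (fun E0 => induced_ms gam (solB gam E0) (fun _ => p1 gam E0))
       (1 / 2) (induced_ms gam (solB0 gam) (fun _ => (gam + 1) / 2))) /\
  (* Case 2 : E0 > 1/2 fixed, gamma -> 1^+ *)
  (forall E0 : R, 1 / 2 < E0 ->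
     msol_conv_right (fun gam => induced_ms gam (solB gam E0) (fun _ => p1 gam E0))
       1 (sing_ms E0) /\
     measure_sol 1 1 E0 (sing_ms E0)).
Proof.
split; last split.
- by move=> gam E0 g /ltW e; exact: shock_solution.
- move=> gam g; have [w m] := shock_solution g (lexx (1 / 2)).
  have lim := energy_limit g.
  by rewrite -(p1_half g) solB0E // in lim *; rewrite -(p1_half g).
- move=> E0 e; split; first exact: gamma_limit.
  by apply: singular_measure_sol; lra.
Qed.
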